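(* Consider $(\mathcal{P}_\infty)$ with expected cost $$J(\underline\gamma)=\limsup_{N\to\infty}\frac1N\mathbb{E}^{\underline\gamma}\Big[\sum_{i=1}^N (u^i)^T R u^i-2\sum_{i=1}^N (u^i)^T D\Big(\underline x+\frac1N\sum_{k=1}^N u^k\Big)+\Big(\underline x+\frac1N\sum_{k=1}^N u^k\Big)^T Q\Big(\underline x+\frac1N\sum_{k=1}^N u^k\Big)\Big],$$ where $R$ is a positive definite matrix, $D$ and $Q$ are positive semi-definite matrices of appropriate dimension, and $R>2D$. Under the measurement scheme $$\underline v^i=H\underline x+\underline z^i,\qquad i\in\mathbb{N},$$ where the $\underline z^i$ are i.i.d. Gaussian random vectors, there are real matrices $\pi_N^*$ ($N\ge 1$) and $\pi_\infty^*$ such that $\gamma_N^{i*}(v^i)=\pi_N^* v^i$, $i=1,\dots,N$, is an optimal policy for $(\mathcal{P}_N)$, the policy $\gamma_\infty^{i*}(v^i)=\pi_\infty^* v^i$, $i\in\mathbb{N}$, is an optimal policy for $(\mathcal{P}_\infty)$, and $\gamma_\infty^{i*}$ is the pointwise limit of $\gamma_N^{i*}$ as $N\to\infty$.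
   Context: Static team: decision maker $i$ observes only the random vector $\underline v^i$ (also written $v^i$), with values in $\mathbb{R}^m$, and applies $u^i=\gamma^i(v^i)\in\mathbb{R}^n$, with $\gamma^i:\mathbb{R}^m\to\mathbb{R}^n$ an arbitrary measurable function (the set of these is $\Gamma^i$). $\underline x$ is an $\mathbb{R}^n$-valued (zero mean) Gaussian random vector with covariance $\mathbb{E}(\underline x\,\underline x^T)=\Sigma_{00}$; the $\underline z^i$ are zero mean, independent of $\underline x$, with covariance $N^0>0$ (positive definite); $H$ is a fixed real $m\times n$ matrix. $R>2D$ means $R-2D$ is positive definite. $\mathbb{E}^{\underline\gamma}$ means that $u^i=\gamma^i(v^i)$ is substituted for all $i$. $(\mathcal{P}_N)$: minimize, over $\underline\gamma_N\in\prod_{i=1}^N\Gamma^i$, the cost $J_N(\underline\gamma_N)$ given by the expression following $\limsup_{N\to\infty}$ in the display defining $J$. $(\mathcal{P}_\infty)$: minimize $J$ over $\prod_{i\in\mathbb{N}}\Gamma^i$. Optimal means attaining the infimum. *)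

(* Defs.v *)
From HB Require Import structures.
From mathcomp Require Import all_boot all_order all_algebra.
From mathcomp Require Import all_classical all_reals all_analysis.

Set Implicit Arguments.
Unset Strict Implicit.
Unset Printing Implicit Defensive.

Import Order.TTheory GRing.Theory Num.Theory.
Import numFieldNormedType.Exports.

Local Open Scope classical_set_scope.
Local Open Scope ring_scope.

(* Matrices carry the sigma-algebra generated by their entries, as the library
   does for tuples; over the reals this is the Borel sigma-algebra. *)
Definition mx_display : measure_display -> measure_display.
Proof. exact. Qed.

Definition mx_measurable (d : measure_display) (T : sigmaRingType d)
    (m n : nat) : set (set 'M[T]_(m, n)) :=
  <<s \bigcup_(ij in [set: 'I_m * 'I_n])
        preimage_set_system setT (fun A : 'M[T]_(m, n) => A ij.1 ij.2)
          measurable >>.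

Section measurable_matrix.
Context (d : measure_display) (T : sigmaRingType d) (m n : nat).

Let mx_set0 : @mx_measurable d T m n set0.
Proof. exact: sigma_algebra0. Qed.

Let mx_setC A : @mx_measurable d T m n A -> @mx_measurable d T m n (~` A).
Proof. exact: sigma_algebraC. Qed.

Let mx_bigcup (F : nat -> set 'M[T]_(m, n)) :
  (forall i, mx_measurable (F i)) -> mx_measurable (\bigcup_i F i).
Proof. exact: sigma_algebra_bigcup. Qed.

HB.instance Definition _ := @isMeasurable.Build (mx_display d) 'M[T]_(m, n)
  (@mx_measurable d T m n) mx_set0 mx_setC mx_bigcup.

End measurable_matrix.

Definition mxbil (K : realType) (n : nat) (M : 'M[K]_n) (u v : 'cV[K]_n) : K :=
  (u^T *m M *m v) 0 0.

Definition posdefmx (K : realType) (n : nat) (M : 'M[K]_n) : Prop :=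
  M^T = M /\ forall u : 'cV[K]_n, u != 0 -> 0 < mxbil M u u.

Definition possemidefmx (K : realType) (n : nat) (M : 'M[K]_n) : Prop :=
  M^T = M /\ forall u : 'cV[K]_n, 0 <= mxbil M u u.

(* [normal_prob mu 0] is not a point mass (it is uniform on [0, 1]), so the
   degenerate Gaussian law has to be treated apart. *)
Definition gaussian_law (K : realType) (mu sigma : K) (A : set K) : \bar K :=
  if sigma == 0 then \d_mu A else normal_prob mu sigma A.

(* Possibly degenerate: every linear functional of X has a Gaussian law. *)
Definition gaussian_vector (d : measure_display) (T : measurableType d)
    (K : realType) (P : probability T K) (k : nat) (X : T -> 'cV[K]_k) : Prop :=
  forall a : 'cV[K]_k, exists mu sigma : K, forall A : set K, measurable A ->
    P ((fun w => (a^T *m X w) 0 0) @^-1` A) = gaussian_law mu sigma A.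

Definition zero_mean (d : measure_display) (T : measurableType d)
    (K : realType) (P : probability T K) (k : nat) (X : T -> 'cV[K]_k) : Prop :=
  forall i : 'I_k, ('E_P[(fun w => X w i 0)%R] = 0)%E.

(* E(X X^T) = S, for a zero-mean X. *)
Definition has_covariance (d : measure_display) (T : measurableType d)
    (K : realType) (P : probability T K) (k : nat) (X : T -> 'cV[K]_k)
    (S : 'M[K]_k) : Prop :=
  forall i j : 'I_k, ('E_P[(fun w => (X w *m (X w)^T) i j)%R] = (S i j)%:E)%E.

Definition identically_distributed (d d' : measure_display)
    (T : measurableType d) (T' : measurableType d') (K : realType)
    (P : probability T K) (I : Type) (X : I -> T -> T') : Prop :=
  forall (i j : I) (A : set T'), measurable A ->
    P (X i @^-1` A) = P (X j @^-1` A).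

Definition mutually_independent (d : measure_display) (T : measurableType d)
    (K : realType) (P : probability T K) (I : eqType)
    (E : I -> set (set T)) : Prop :=
  forall (J : seq I) (A : I -> set T), uniq J ->
    (forall j, j \in J -> E j (A j)) ->
    P (\bigcap_(j in [set` J]) A j) = (\prod_(j <- J) P (A j))%E.

(* Mutual independence of x, z 0, z 1, ...; [None] is the index of x. *)
Definition independent_noise (d d1 d2 : measure_display)
    (T : measurableType d) (T1 : measurableType d1) (T2 : measurableType d2)
    (K : realType) (P : probability T K)
    (x : T -> T1) (z : nat -> T -> T2) : Prop :=
  mutually_independent P (fun k : option nat =>
    if k is Some i then preimage_set_system setT (z i) measurable
    else preimage_set_system setT x measurable).

(* Policies (gamma i)_i, the index set I being 'I_N or nat. *)
Definition policies (K : realType) (m n : nat) (I : Type) :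
    set (I -> 'cV[K]_m -> 'cV[K]_n) :=
  [set g | forall i, measurable_fun setT (g i)].

Definition optimal (K : realType) (S : Type) (A : set S) (J : S -> \bar K)
    (g : S) : Prop :=
  A g /\ J g = ereal_inf (J @` A).

Definition observation (K : realType) (T : Type) (m n : nat)
    (H : 'M[K]_(m, n)) (x : T -> 'cV[K]_n) (z : nat -> T -> 'cV[K]_m)
    (i : nat) (w : T) : 'cV[K]_m :=
  H *m x w + z i w.

Definition team_loss (K : realType) (n : nat) (R D Q : 'M[K]_n) (N : nat)
    (x : 'cV[K]_n) (u : 'I_N -> 'cV[K]_n) : K :=
  let y := x + N%:R^-1 *: \sum_(k < N) u k in
  \sum_(i < N) mxbil R (u i) (u i) - 2 * \sum_(i < N) mxbil D (u i) y
    + mxbil Q y y.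

(* Under R > 2D the loss is bounded below by an integrable random variable, so
   this expectation is well defined in ]-oo, +oo] for every policy. *)
Definition team_cost (d : measure_display) (T : measurableType d)
    (K : realType) (P : probability T K) (m n : nat) (R D Q : 'M[K]_n)
    (x : T -> 'cV[K]_n) (v : nat -> T -> 'cV[K]_m) (N : nat)
    (g : 'I_N -> 'cV[K]_m -> 'cV[K]_n) : \bar K :=
  ((N%:R^-1)%:E *
   'E_P[(fun w => team_loss R D Q (x w) (fun i : 'I_N => g i (v i w)))%R])%E.

Definition limit_cost (d : measure_display) (T : measurableType d)
    (K : realType) (P : probability T K) (m n : nat) (R D Q : 'M[K]_n)
    (x : T -> 'cV[K]_n) (v : nat -> T -> 'cV[K]_m)
    (g : nat -> 'cV[K]_m -> 'cV[K]_n) : \bar K :=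
  limn_esup (fun N => team_cost P R D Q x v (fun i : 'I_N => g i)).

(* Main.v *)
Require Import Defs.
From HB Require Import structures.
From mathcomp Require Import all_boot all_order all_algebra.
From mathcomp Require Import all_classical all_reals all_analysis.
From mathcomp Require Import measurable_realfun ring lra.

Set Implicit Arguments.
Unset Strict Implicit.
Unset Printing Implicit Defensive.

Import Order.TTheory GRing.Theory Num.Theory.
Import numFieldNormedType.Exports.

Local Open Scope classical_set_scope.
Local Open Scope ring_scope.

(** Write t = 1/N, let u i be the linear policy with gain p applied to the
    observation v i = H x + z i, and let y = x + t (u 1 + ... + u N). The loss
    is a quadratic function of the decisions. Around u, a perturbation e
    changes it by
      2 sum_i <e i, r i> + (a quadratic form in e),
    where r i, half the partial gradient at u, is a linear function of
    x, z 1, ..., z N. Since R > 2D and the mean of the e i satisfies the Jensen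
    inequality for the form D, the quadratic form is at least
    sum_i <e i, (R - 2D) e i> (team_curvature_ge). Hence the policy with gain p
    is optimal as soon as E<e i, r i> = 0 for every square-integrable
    perturbation e i depending on v i alone, that is, as soon as the
    conditional mean of r i given v i vanishes.

    For jointly Gaussian vectors this means that r i and v i are uncorrelated
    (uncorrelated_orthogonal), which is a linear equation for p, with
    coefficients that are polynomials in t (gain_op, residual_uncorrelated).
    Its operator is coercive, uniformly in t between 0 and 1
    (gain_op_coercive), so that the equation has a solution p t for each such
    t and p t = p 0 + O(t) (optimal_gain). The gains of the theorem are p (1/N)
    and p 0.

    A policy of finite cost is square-integrable because the loss dominates a
    multiple of sum_i |e i|^2 up to an integrable term
    (policy_loss_dichotomy). This gives optimality for finite N
    (linear_policy_le). The quadratic form is at most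
    sum_i <e i, (R + Q) e i>, so the gain p 0 costs at most O(t^2) more than
    p t in the problem of size N (linear_policy_gap). The N-th cost of any
    policy is therefore at least that of the gain p 0 minus O(t^2), and its
    upper limit is at least that of the gain p 0.

    The Gaussian part rests on the law of x and of each z k being known only
    through linear functionals. The Stein identity for the normal density gives
    E cos (X + b) = exp (- E X^2 / 2) cos b for centred Gaussian X
    (gaussian_cos), independence extends it to linear functions of
    x, z 1, ..., z N (gaussian_cosine_sum), and a second-order comparison shows
    that a linear function Y uncorrelated with such an X satisfies
    E (Y cos (X + b)) = 0 (uncorrelated_cos). Finally, the functions h such that
    multiplication by h preserves orthogonality to the cosines of the linear
    functionals of V form an algebra closed under bounded limits. It contains
    those cosines, hence the signs of V j - a, hence the indicators of all
    events depending on V (mean_indic_eq0). *)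

(** * Expectations and square-integrable random variables *)

Section Expectation.
Context (d : measure_display) (T : measurableType d) (K : realType)
  (P : probability T K).
Implicit Types f g : T -> K.

Definition mean f : K := \int[P]_w f w.

Definition L1 f : Prop := P.-integrable setT (EFin \o f).

Definition L2 f : Prop := measurable_fun setT f /\ L1 (fun w => f w ^+ 2).

Lemma L1_measurable f : L1 f -> measurable_fun setT f.
Proof. by move=> /integrableP[/measurable_EFinP]. Qed.

Lemma le_L1 f g : measurable_fun setT f -> (forall w, `|f w| <= g w) ->
  L1 g -> L1 f.
Proof.
move=> mf fg; apply: le_integrable => //; first exact/measurable_EFinP.
by move=> w _ /=; rewrite lee_fin (le_trans (fg w))// ler_norm.
Qed.

Lemma L1D f g : L1 f -> L1 g -> L1 (fun w => f w + g w).
Proof. by move=> lf lg; exact: (integrableD measurableT lf lg). Qed.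

Lemma L1Z a f : L1 f -> L1 (fun w => a * f w).
Proof. by move=> lf; exact: (integrableZl measurableT a lf). Qed.

Lemma L1N f : L1 f -> L1 (fun w => - f w).
Proof. by move=> lf; exact: (integrableN lf). Qed.

Lemma L1B f g : L1 f -> L1 g -> L1 (fun w => f w - g w).
Proof. by move=> lf lg; apply: L1D => //; exact: L1N. Qed.

Lemma L1_norm f : L1 f -> L1 (fun w => `|f w|).
Proof. exact: integrable_norm. Qed.

Lemma L1_cst a : L1 (fun=> a).
Proof. exact: finite_measure_integrable_cst. Qed.

Lemma L1_sum (I : Type) (s : seq I) (h : I -> T -> K) :
  (forall i, L1 (h i)) -> L1 (fun w => \sum_(i <- s) h i w).
Proof.
move=> lh; elim: s => [|i s ih].
  by under eq_fun do rewrite big_nil; exact: L1_cst.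
by under eq_fun do rewrite big_cons; exact: L1D.
Qed.

Lemma L1_bounded f (M : K) : measurable_fun setT f -> (forall w, `|f w| <= M) ->
  L1 f.
Proof. by move=> mf fM; exact: (le_L1 mf fM (L1_cst M)). Qed.

Lemma L1_mul_bounded f g (M : K) : L1 f -> measurable_fun setT g ->
  (forall w, `|g w| <= M) -> L1 (fun w => f w * g w).
Proof.
move=> lf mg gM; apply: (@le_L1 _ (fun w => M * `|f w|)).
- by apply: measurable_funM => //; exact: L1_measurable.
- by move=> w; rewrite normrM mulrC ler_wpM2r.
- exact/L1Z/L1_norm.
Qed.

Lemma mean_cst a : mean (fun=> a) = a.
Proof.
by rewrite /mean Rintegral_cst//= [X in fine X]probability_setT mulr1.
Qed.

Lemma meanD f g : L1 f -> L1 g -> mean (fun w => f w + g w) = mean f + mean g.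
Proof. by move=> *; exact: RintegralD. Qed.

Lemma meanB f g : L1 f -> L1 g -> mean (fun w => f w - g w) = mean f - mean g.
Proof. by move=> *; exact: RintegralB. Qed.

Lemma meanZ a f : L1 f -> mean (fun w => a * f w) = a * mean f.
Proof. by move=> *; exact: RintegralZl. Qed.

Lemma meanN f : L1 f -> mean (fun w => - f w) = - mean f.
Proof.
move=> lf; rewrite -mulN1r -meanZ//.
by congr mean; apply/funext => w; rewrite mulN1r.
Qed.

Lemma mean_sum (I : Type) (s : seq I) (h : I -> T -> K) :
  (forall i, L1 (h i)) ->
  mean (fun w => \sum_(i <- s) h i w) = \sum_(i <- s) mean (h i).
Proof.
move=> lh; elim: s => [|i s ih].
  by rewrite big_nil -[RHS]mean_cst; under eq_fun do rewrite big_nil.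
by rewrite big_cons -ih -meanD//;
  [under eq_fun do rewrite big_cons|exact: L1_sum].
Qed.

Lemma le_mean f g : L1 f -> L1 g -> (forall w, f w <= g w) -> mean f <= mean g.
Proof. by move=> lf lg fg; apply: le_Rintegral. Qed.

Lemma mean_ge0 f : (forall w, 0 <= f w) -> 0 <= mean f.
Proof. by move=> f0; exact: Rintegral_ge0. Qed.

Lemma ler_norm_mean f g : L1 f -> L1 g -> (forall w, `|f w| <= g w) ->
  `|mean f| <= mean g.
Proof.
move=> lf lg fg; rewrite ler_norml -meanN//; apply/andP; split.
  apply: le_mean => //; first exact: L1N.
  by move=> w; rewrite lerNl; apply: le_trans (fg w); rewrite -normrN ler_norm.
by apply: le_mean => // w; apply: le_trans (fg w); rewrite ler_norm.
Qed.

Lemma L2_measurable f : L2 f -> measurable_fun setT f.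
Proof. by case. Qed.

Lemma L2M f g : L2 f -> L2 g -> L1 (fun w => f w * g w).
Proof.
move=> [mf lf] [mg lg]; apply: (@le_L1 _ (fun w => f w ^+ 2 + g w ^+ 2)).
- exact: measurable_funM.
- move=> w; rewrite normrM -(real_normK (num_real (f w))).
  rewrite -(real_normK (num_real (g w))).
  by have := sqr_ge0 (`|f w| - `|g w|); nra.
- exact: L1D.
Qed.

Lemma L2_cst a : L2 (fun=> a).
Proof. by split; [exact: measurable_cst|exact: L1_cst]. Qed.

Lemma L2_L1 f : L2 f -> L1 f.
Proof.
by move=> /L2M /(_ (L2_cst 1)); under eq_fun do rewrite mulr1.
Qed.

Lemma L2Z a f : L2 f -> L2 (fun w => a * f w).
Proof.
move=> [mf lf]; split; first exact: measurable_funM.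
by under eq_fun do rewrite exprMn; exact: L1Z.
Qed.

Lemma L2D f g : L2 f -> L2 g -> L2 (fun w => f w + g w).
Proof.
move=> lf lg; split.
  by apply: measurable_funD; exact: L2_measurable.
under eq_fun do rewrite sqrrD.
by apply: L1D;
  [apply: L1D;
  [case: lf|rewrite /L1 /comp; under eq_fun do rewrite -mulr_natl; apply: L1Z;
  exact: L2M]|case: lg].
Qed.

Lemma L2N f : L2 f -> L2 (fun w => - f w).
Proof. by move=> /(L2Z (-1)); under eq_fun do rewrite mulN1r. Qed.

Lemma L2B f g : L2 f -> L2 g -> L2 (fun w => f w - g w).
Proof. by move=> lf lg; apply: L2D => //; exact: L2N. Qed.

Lemma L2_sum (I : Type) (s : seq I) (h : I -> T -> K) :
  (forall i, L2 (h i)) -> L2 (fun w => \sum_(i <- s) h i w).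
Proof.
move=> lh; elim: s => [|i s ih].
  by under eq_fun do rewrite big_nil; exact: L2_cst.
by under eq_fun do rewrite big_cons; exact: L2D.
Qed.

Lemma le_L2 f g : measurable_fun setT f -> (forall w, f w ^+ 2 <= g w) ->
  L1 g -> L2 f.
Proof.
move=> mf fg lg; split=> //; apply: le_L1 lg; first exact: measurable_funX.
by move=> w; rewrite ger0_norm ?sqr_ge0.
Qed.

Lemma cvg_mean (h : nat -> T -> K) f g :
  (forall k, measurable_fun setT (h k)) ->
  (forall w, h k w @[k --> \oo] --> f w) ->
  (forall k w, `|h k w| <= g w) -> L1 g ->
  L1 f /\ mean (h k) @[k --> \oo] --> mean f.
Proof.
move=> mh hf hg lg.
have mf : measurable_fun setT f.
  exact: (@measurable_fun_cvg _ _ _ _ h).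
have lf : L1 f.
  apply: le_L1 lg => // w;
    have hfw : `|h k w| @[k --> \oo] --> `|f w| by exact: cvg_norm.
  rewrite -(cvg_lim _ hfw)//; apply: limr_le; last exact: nearW.
  by apply/cvg_ex; exists `|f w|.
split=> //.
have -> : mean f = fine (\int[P]_w (f w)%:E)%E by [].
have : (\int[P]_w (h k w)%:E)%E @[k --> \oo] --> (\int[P]_w (f w)%:E)%E.
  apply: (@dominated_cvg _ _ _ P setT measurableT (fun k => EFin \o h k)
    (EFin \o f) (EFin \o g)) => //.
  - by move=> k; exact/measurable_EFinP.
  - by move=> w _; apply/cvg_EFin; [exact: nearW|exact: hf].
  - by move=> k w _; rewrite /= lee_fin.
have fE : (\int[P]_w (f w)%:E)%E \is a fin_num by exact: integrable_fin_num.
by rewrite -{1}(fineK fE) => /fine_cvgP[].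
Qed.

Lemma cvg_mean_unique (h : nat -> T -> K) f g l :
  (forall k, measurable_fun setT (h k)) ->
  (forall w, h k w @[k --> \oo] --> f w) ->
  (forall k w, `|h k w| <= g w) -> L1 g ->
  mean (h k) @[k --> \oo] --> l -> mean f = l.
Proof.
move=> mh hf hg lg; have [_ hl] := cvg_mean mh hf hg lg.
exact: (cvg_unique _ hl).
Qed.

End Expectation.

(** * Trigonometric estimates *)

Section Trigo.
Context (K : realType).
Implicit Types x y h s : K.

Lemma measurable_sin : measurable_fun setT (@sin K).
Proof. by apply: continuous_measurable_fun; exact: continuous_sin. Qed.

Lemma measurable_cos : measurable_fun setT (@cos K).
Proof. by apply: continuous_measurable_fun; exact: continuous_cos. Qed.

Lemma sin_lipschitz x y : `|sin x - sin y| <= `|x - y|.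
Proof.
wlog xy : x y / y <= x.
  by move=> H; case: (leP y x) => [/H//|/ltW/H]; rewrite distrC (distrC x).
have [c _ ->] : exists2 c, c \in `[y, x] & sin x - sin y = cos c * (x - y).
  apply: MVT_segment => //.
  exact/continuous_subspaceT/continuous_sin.
by rewrite normrM ler_piMl// cos_max.
Qed.

(** The mean value theorem gives cos (x + h) - cos x = - h sin c with c between
    x and x + h, and sin c is within |h| of sin x. *)
Lemma cos_expansion x h : `|cos (x + h) - cos x + h * sin x| <= h ^+ 2.
Proof.
have H (a b : K) : a <= b -> forall e, (e = a \/ e = b) ->
    `|cos b - cos a + (b - a) * sin e| <= (b - a) ^+ 2.
  move=> ab e abe.
  have [c] : exists2 c, c \in `[a, b] & cos b - cos a = (- sin c) * (b - a).
    apply: MVT_segment => //.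
    exact/continuous_subspaceT/continuous_cos.
  rewrite in_itv/= => /andP[ac cb] ->.
  have -> : - sin c * (b - a) + (b - a) * sin e = (b - a) * (sin e - sin c).
    by ring.
  rewrite normrM expr2.
  rewrite (ger0_norm (_ : 0 <= b - a)) ?subr_ge0//.
  apply: ler_wpM2l; first by rewrite subr_ge0.
  apply: le_trans (sin_lipschitz _ _) _.
  by case: abe => ->; rewrite ler_norml; lra.
case: (leP 0 h) => h0.
  have := @H x (x + h) _ x (or_introl erefl); rewrite lerDl => /(_ h0).
  by rewrite (_ : x + h - x = h)//; ring.
have := @H (x + h) x _ x (or_intror erefl); rewrite gerDl => /(_ (ltW h0)).
rewrite (_ : x - (x + h) = - h); last by ring.
rewrite sqrrN -normrN; congr (`|_| <= _); ring.
Qed.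

Lemma sin_expansion h : `|sin h - h| <= h ^+ 2.
Proof.
have := cos_expansion (- (pi / 2)) h.
by rewrite sinN sin_pihalf cosN cos_pihalf [X in cos X]addrC cosBpihalf subr0
  mulrN1.
Qed.

Lemma ler_sin x : `|sin x| <= `|x|.
Proof. by have := sin_lipschitz x 0; rewrite sin0 !subr0. Qed.

(** These functions converge to the identity, are dominated by it, and are
    bounded: a truncation that stays trigonometric. *)
Definition sin_dilate (k : nat) x := k.+1%:R * sin (x / k.+1%:R).

Lemma sin_dilate_le k x : `|sin_dilate k x| <= `|x|.
Proof.
rewrite /sin_dilate normrM;
  apply: (@le_trans _ _ (`|k.+1%:R| * `|x / k.+1%:R|)).
  by rewrite ler_wpM2l// ler_sin.
by rewrite -normrM mulrC divfK// pnatr_eq0.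
Qed.

Lemma cvg_harmonic_scale x : x / k.+1%:R @[k --> \oo] --> (0 : K).
Proof.
rewrite -[X in _ --> X](mulr0 x); apply: cvgM; first exact: cvg_cst.
exact: cvg_harmonic.
Qed.

Lemma cvg_sin_dilate x : sin_dilate k x @[k --> \oo] --> x.
Proof.
apply/cvgrPdist_le => e e0.
have /cvgrPdist_le /(_ e e0) := cvg_harmonic_scale (x ^+ 2).
apply: filterS => k; rewrite sub0r normrN => ke.
apply: le_trans ke; rewrite [leRHS]ger0_norm ?divr_ge0 ?sqr_ge0//.
have k0 : k.+1%:R != 0 :> K by rewrite pnatr_eq0.
have k1 : 0 < k.+1%:R :> K by rewrite ltr0n.
have -> : x - sin_dilate k x = - k.+1%:R * (sin (x / k.+1%:R) - x / k.+1%:R).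
  by rewrite /sin_dilate; field.
rewrite normrM normrN (gtr0_norm k1).
apply: (@le_trans _ _ (k.+1%:R * (x / k.+1%:R) ^+ 2)).
  by rewrite (ler_pM2l k1) sin_expansion.
by rewrite le_eqVlt; apply/orP; left; apply/eqP; field.
Qed.

(** The Newton step for the equation s^2 = 1. Its iterates are polynomials in s
    that converge on [-1, 1] to the sign. *)
Definition sg_step s := (3 * s - s ^+ 3) / 2.

Lemma sg_stepN s : sg_step (- s) = - sg_step s.
Proof. by rewrite /sg_step; field. Qed.

Lemma iter_sg_step_bound k s : `|s| <= 1 -> `|iter k sg_step s| <= 1.
Proof.
move=> s1; elim: k => //= k; move: (iter _ _ _) => r.
rewrite !ler_norml => /andP[r1 r2].
have := mulr_ge0 (sqr_ge0 (r - 1)) (_ : 0 <= r + 2).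
have := mulr_ge0 (sqr_ge0 (r + 1)) (_ : 0 <= 2 - r).
rewrite /sg_step => /(_ ltac:(lra)) H1 /(_ ltac:(lra)) H2.
by apply/andP; split; nra.
Qed.

Lemma cvg_iter_sg_step s : `|s| <= 1 ->
  iter k sg_step s @[k --> \oo] --> Num.sg s.
Proof.
wlog s0 : s / 0 <= s.
  move=> H s1; have [s0|s0] := leP 0 s; first exact: H.
  have := H (- s); rewrite oppr_ge0 normrN => /(_ (ltW s0) s1).
  move=> /cvgN; rewrite sgrN opprK; apply: cvg_trans.
  rewrite (_ :
    (fun k => iter k sg_step s) = - (fun k => iter k sg_step (- s)))//.
  apply/funext => k; rewrite fctE; apply/eqP; rewrite eq_sym eqr_oppLR;
    apply/eqP.
  by elim: k => //= k ->; rewrite sg_stepN.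
move=> s1; have [->|sn0] := eqVneq s 0.
  rewrite sgr0 (_ : (fun k => _) = cst 0); first exact: cvg_cst.
  by apply/funext => k; elim: k => //= k ->; rewrite /sg_step/=; field.
have {s0 sn0} s0 : 0 < s by rewrite lt_neqAle eq_sym sn0.
rewrite gtr0_sg//.
pose c := 1 - s / 2.
(* 1 - sg_step r = (1 - r) (1 - r (1 + r) / 2), and r >= s bounds the last
   factor by c. *)
have H k : s <= iter k sg_step s <= 1 /\ 1 - iter k sg_step s <= c ^+ k.
  elim: k => [|k [/andP[]]] /=.
    by rewrite lexx expr0; move: s1; rewrite ler_norml; lra.
  move: (iter _ _ _) => r sr r1 rc; rewrite exprS.
  have -> : 1 - sg_step r = (1 - r) * (1 - r * (1 + r) / 2).
    by rewrite /sg_step; field.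
  have r0 : 0 <= r by apply: le_trans sr; exact: ltW.
  have rr : r * r <= 1 by rewrite -[leRHS](mulr1 1) ler_pM.
  split.
    have := mulr_ge0 (sqr_ge0 (r - 1)) (_ : 0 <= r + 2).
    have := mulr_ge0 r0 (_ : 0 <= 1 - r * r).
    rewrite /sg_step => /(_ ltac:(lra)) H1 /(_ ltac:(lra)) H2.
    by apply/andP; split; nra.
  rewrite (mulrC c); apply: ler_pM => //; rewrite ?/c; nra.
apply/cvgrPdist_le => e e0.
have : geometric 1 c k @[k --> \oo] --> (0 : K).
  apply: cvg_geometric; rewrite /c ltr_norml; move: s1; rewrite ler_norml; lra.
move=> /cvgrPdist_le /(_ e e0); apply: filterS => k; rewrite sub0r normrN /=.
move=> ke; have [/andP[_ k1] kc] := H k.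
rewrite ger0_norm ?subr_ge0//; apply: le_trans kc _.
by apply: le_trans ke; rewrite mul1r ler_norm.
Qed.

End Trigo.

(** * Orthogonality to functions of a random variable *)

Section Orthogonality.
Import HBNNSimple.
Context (d : measure_display) (T : measurableType d) (K : realType)
  (P : probability T K).
Implicit Types e F : T -> K.

Let mean_mul_sfun0 e (d' : measure_display) (T' : measurableType d')
    (X : T -> T') (phi : {nnsfun T' >-> K}) :
  L1 P e -> measurable_fun setT X ->
  (forall B, measurable B -> mean P (fun w => e w * \1_B (X w)) = 0) ->
  mean P (fun w => e w * phi (X w)) = 0.
Proof.
move=> le mX e0.
under [in mean _ _]eq_fun do rewrite fimfunE fsbig_finite//= mulr_sumr.
rewrite mean_sum => [|y].
  rewrite big1// => y _; under eq_fun do rewrite mulrCA.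
  have mB : measurable (phi @^-1` [set y]) by exact: measurable_funPTI.
  rewrite meanZ ?e0 ?mulr0//.
  apply: (@L1_mul_bounded _ _ _ _ _ _ 1) => //.
    exact: (measurableT_comp (measurable_indic mB) mX).
  by move=> w; rewrite indicE; case: (_ \in _); rewrite ?normr1 ?normr0.
under eq_fun do rewrite mulrCA; apply: L1Z.
have mB : measurable (phi @^-1` [set y]) by exact: measurable_funPTI.
apply: (@L1_mul_bounded _ _ _ _ _ _ 1) => //.
  exact: (measurableT_comp (measurable_indic mB) mX).
by move=> w; rewrite indicE; case: (_ \in _); rewrite ?normr1 ?normr0.
Qed.

(** The positive and negative parts of g are increasing limits of simple
    functions, and |e g(X)| dominates the products with e. *)
Lemma mean_mul_eq0 e (d' : measure_display) (T' : measurableType d')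
    (X : T -> T') (g : T' -> K) :
  L1 P e -> measurable_fun setT X -> measurable_fun setT g ->
  L1 P (fun w => e w * g (X w)) ->
  (forall B, measurable B -> mean P (fun w => e w * \1_B (X w)) = 0) ->
  mean P (fun w => e w * g (X w)) = 0.
Proof.
move=> le mX mg leg e0.
have main (h : T' -> K) : measurable_fun setT h ->
    (forall y, 0 <= h y) -> (forall y, h y <= `|g y|) ->
    L1 P (fun w => e w * h (X w)) /\ mean P (fun w => e w * h (X w)) = 0.
  move=> mh h0 hg.
  have mhE : measurable_fun setT (EFin \o h) by exact/measurable_EFinP.
  pose phi := nnsfun_approx measurableT mhE.
  have phih k y : phi k y <= h y.
    by rewrite -lee_fin /phi nnsfun_approxE le_approx// => ? _; rewrite lee_fin.
  have hphi y : phi k y @[k --> \oo] --> h y.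
    have := @cvg_nnsfun_approx _ _ _ _ measurableT _ mhE (fun y _ => h0 y) y I.
    by move=> /fine_cvgP[].
  have lg : L1 P (fun w => `|e w * g (X w)|) by exact: L1_norm.
  have meas (u : T' -> K) : measurable_fun setT u ->
      measurable_fun setT (fun w => e w * u (X w)).
    move=> mu; apply: measurable_funM; first exact: L1_measurable le.
    exact: measurableT_comp.
  have [] := @cvg_mean _ _ _ P (fun k w => e w * phi k (X w))
      (fun w => e w * h (X w)) (fun w => `|e w * g (X w)|).
  - by move=> k; apply: meas.
  - by move=> w; apply: cvgM; [exact: cvg_cst|exact: hphi].
  - move=> k w; rewrite !normrM ler_wpM2l// ger0_norm//.
    exact: le_trans (phih _ _) (hg _).
  - by [].
  move=> lh eh; split=> //; apply: (cvg_unique _ eh) => //.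
  by apply: cvg_near_cst; apply: nearW => k; exact: mean_mul_sfun0.
have mpos (s : T' -> K) : measurable_fun setT s ->
    measurable_fun setT (fun y => Num.max (s y) 0).
  by move=> ms; apply: measurable_maxr.
have mN : measurable_fun setT (fun y => - g y) by exact: measurableT_comp.
have [||l1 m1] := main _ (mpos _ mg).
- by move=> y; rewrite le_max lexx orbT.
- by move=> y; rewrite ge_max normr_ge0 ler_norm.
have [||l2 m2] := main _ (mpos _ mN).
- by move=> y; rewrite le_max lexx orbT.
- by move=> y; rewrite ge_max normr_ge0 -normrN ler_norm.
rewrite (_ : (fun w => _) = fun w => e w * Num.max (g (X w)) 0 -
    e w * Num.max (- g (X w)) 0); first by rewrite meanB// m1 m2 subr0.
apply/funext => w; rewrite -mulrBr; congr (_ * _).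
by rewrite /Num.max; case: ltP => ?; case: ltP => ?; lra.
Qed.

End Orthogonality.

(** * Cosines determine conditional means *)

Lemma preimage_sigma_algebra (T rT : Type) (S : set (set T)) (f : T -> rT)
    (G : set (set rT)) :
  sigma_algebra setT S -> (forall B, G B -> S (f @^-1` B)) ->
  forall B, <<s G >> B -> S (f @^-1` B).
Proof.
move=> [S0 SC SU] GS; apply: smallest_sub; last exact: GS.
split=> [|B SB|F SF].
- by rewrite preimage_set0.
- by rewrite setTD preimage_setC -setTD; exact: SC.
- by rewrite preimage_bigcup; exact: SU.
Qed.

Section CosineDetermining.
Context (d : measure_display) (T : measurableType d) (K : realType)
  (P : probability T K) (m : nat).
Variables (e : T -> K) (v : T -> 'cV[K]_m).
Hypothesis le : L1 P e.
Hypothesis mv : forall j, measurable_fun setT (fun w => v w j 0).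

Let cosv (a : 'cV[K]_m) (b : K) (w : T) : K := cos ((a^T *m v w) 0 0 + b).

Hypothesis e0 : forall a b, mean P (fun w => e w * cosv a b w) = 0.

Let bounded_measurable (g : T -> K) :=
  measurable_fun setT g /\ exists M, forall w, `|g w| <= M.

(** Testing against every cosine, and not only against 1, makes this class
    stable under multiplication by a cosine. *)
Let testfun (g : T -> K) := bounded_measurable g /\
  forall a b, mean P (fun w => e w * (g w * cosv a b w)) = 0.

(** Unlike the test functions, the multipliers are stable under products. *)
Let multiplier (h : T -> K) := bounded_measurable h /\
  forall g, testfun g -> testfun (fun w => g w * h w).

Let bm_cst c : bounded_measurable (fun=> c).
Proof. by split; [exact: measurable_cst|exists `|c|]. Qed.

Let bmD g h : bounded_measurable g -> bounded_measurable h ->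
  bounded_measurable (fun w => g w + h w).
Proof.
move=> [mg [M gM]] [mh [N hN]]; split; first exact: measurable_funD.
by exists (M + N) => w; apply: le_trans (ler_normD _ _) _; exact: lerD.
Qed.

Let bmM g h : bounded_measurable g -> bounded_measurable h ->
  bounded_measurable (fun w => g w * h w).
Proof.
move=> [mg [M gM]] [mh [N hN]]; split; first exact: measurable_funM.
by exists (M * N) => w; rewrite normrM; exact: ler_pM.
Qed.

Let bm_cosv a b : bounded_measurable (cosv a b).
Proof.
split; last by exists 1 => w; exact: cos_max.
apply: measurableT_comp; first exact: measurable_cos.
apply: measurable_funD; last exact: measurable_cst.
under eq_fun do rewrite mxE.
by apply: measurable_sum => j; apply: measurable_funM => //;
  exact: measurable_cst.
Qed.

Let le_bm g : bounded_measurable g -> L1 P (fun w => e w * g w).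
Proof. by move=> [mg [M gM]]; exact: L1_mul_bounded gM. Qed.

Let testfun1 : testfun (fun=> 1).
Proof.
split; first exact: bm_cst.
by move=> a b; under eq_fun do rewrite mul1r; exact: e0.
Qed.

Let testfunD g h : testfun g -> testfun h -> testfun (fun w => g w + h w).
Proof.
move=> [bg g0] [bh h0]; split; first exact: bmD.
move=> a b; under eq_fun do rewrite mulrDl mulrDr.
by rewrite meanD ?g0 ?h0 ?addr0//; apply: le_bm; apply: bmM.
Qed.

Let testfunZ c g : testfun g -> testfun (fun w => g w * c).
Proof.
move=> [bg g0]; split; first by apply: bmM.
move=> a b; under eq_fun do rewrite (mulrC (g _)) -mulrA mulrCA.
by rewrite meanZ ?g0 ?mulr0//; apply: le_bm; apply: bmM.
Qed.

Let bm_cvg (h : nat -> T -> K) g M : (forall k, bounded_measurable (h k)) ->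
  (forall k w, `|h k w| <= M) -> (forall w, h k w @[k --> \oo] --> g w) ->
  bounded_measurable g.
Proof.
move=> bh hM hg; split.
  by apply: (@measurable_fun_cvg _ _ _ _ h) => // k; case: (bh k).
exists M => w; have hgw : `|h k w| @[k --> \oo] --> `|g w| by exact: cvg_norm.
rewrite -(cvg_lim _ hgw)//; apply: limr_le; last exact: nearW.
by apply/cvg_ex; exists `|g w|.
Qed.

Let testfun_cvg (h : nat -> T -> K) g M : (forall k, testfun (h k)) ->
  (forall k w, `|h k w| <= M) -> (forall w, h k w @[k --> \oo] --> g w) ->
  testfun g.
Proof.
move=> th hM hg.
have bg : bounded_measurable g by apply: bm_cvg hM hg => k; case: (th k).
split=> // a b.
apply: (@cvg_mean_unique _ _ _ P (fun k w => e w * (h k w * cosv a b w)) _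
    (fun w => `|e w| * M)).
- move=> k; apply: measurable_funM; first exact: L1_measurable le.
  apply: measurable_funM; first by case: (th k) => -[].
  by case: (bm_cosv a b).
- move=> w; apply: cvgM; first exact: cvg_cst.
  by apply: cvgM; [exact: hg|exact: cvg_cst].
- move=> k w; rewrite normrM ler_wpM2l// normrM -[leRHS]mulr1 ler_pM//.
  exact: cos_max.
- apply: (@L1_mul_bounded _ _ _ _ _ _ `|M|) => //; exact: L1_norm.
- by apply: cvg_near_cst; apply: nearW => k; case: (th k).
Qed.

Let mult_cst c : multiplier (fun=> c).
Proof. by split; [exact: bm_cst|move=> g tg; exact: testfunZ]. Qed.

Let multD g h : multiplier g -> multiplier h ->
  multiplier (fun w => g w + h w).
Proof.
move=> [bg tg] [bh th]; split; first exact: bmD.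
by move=> u tu; under eq_fun do rewrite mulrDr; apply: testfunD; auto.
Qed.

Let multM g h : multiplier g -> multiplier h ->
  multiplier (fun w => g w * h w).
Proof.
move=> [bg tg] [bh th]; split; first exact: bmM.
by move=> u tu; under eq_fun do rewrite mulrA; apply: th; auto.
Qed.

Let mult_cvg (h : nat -> T -> K) g M : (forall k, multiplier (h k)) ->
  (forall k w, `|h k w| <= M) -> (forall w, h k w @[k --> \oo] --> g w) ->
  multiplier g.
Proof.
move=> mh hM hg; split; first by apply: bm_cvg hM hg => k; case: (mh k).
move=> u tu; have [[_ [N uN]] _] := tu.
apply: (@testfun_cvg (fun k w => u w * h k w) _ (N * M)).
- by move=> k; case: (mh k) => _; apply.
- by move=> k w; rewrite normrM; exact: ler_pM.
- by move=> w; apply: cvgM; [exact: cvg_cst|exact: hg].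
Qed.

(** A product of two cosines is half the sum of two cosines. *)
Let mult_cos a b : multiplier (cosv a b).
Proof.
split=> // g [bg g0]; split; first exact: bmM.
move=> a' b'.
pose c := fun w => 2^-1 * (e w * (g w * cosv (a + a') (b + b') w)) +
  2^-1 * (e w * (g w * cosv (a - a') (b - b') w)).
rewrite (_ : (fun w => _) = c).
  rewrite meanD; [|by apply/L1Z/le_bm/bmM..].
  by rewrite !meanZ ?g0 ?mulr0 ?addr0//; exact/le_bm/bmM.
apply/funext => w;
  rewrite /c /cosv [(a + a')^T]linearD [(a - a')^T]linearB/= mulmxBl mulmxDl.
rewrite !mxE/=; set A := \sum_j _; set B := \sum_j _.
rewrite (_ : A + B + (b + b') = (A + b) + (B + b')); last by ring.
rewrite (_ : A - B + (b - b') = (A + b) - (B + b')); last by ring.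
by rewrite (cosB (A + b)) (cosD (A + b) (B + b')); field.
Qed.

Let mult_sin (a : 'cV[K]_m) b :
  multiplier (fun w => sin ((a^T *m v w) 0 0 + b)).
Proof.
have := mult_cos a (b - pi / 2).
by rewrite /cosv; under eq_fun do rewrite addrA cosBpihalf.
Qed.

(** The iterates of sg_step are polynomials, so multipliers when evaluated at a
    sine, and they are bounded by 1. *)
Let mult_sg_sin (a : 'cV[K]_m) b :
  multiplier (fun w => Num.sg (sin ((a^T *m v w) 0 0 + b))).
Proof.
pose s w := sin ((a^T *m v w) 0 0 + b).
have s1 w : `|s w| <= 1 by exact: sin_max.
apply: (@mult_cvg (fun k w => iter k (@sg_step K) (s w)) _ 1).
- elim=> [|k ih] /=; first exact: mult_sin.
  rewrite /sg_step (_ : (fun w => _) = fun w =>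
    (fun w => 3 * iter k (@sg_step K) (s w) +
      (-1) * (iter k (@sg_step K) (s w) *
       (iter k (@sg_step K) (s w) * iter k (@sg_step K) (s w)))) w * 2^-1).
    apply: multM; last exact: mult_cst.
    apply: multD; (apply: multM; first exact: mult_cst); first exact: ih.
    by apply: multM; first exact: ih; apply: multM; exact: ih.
  by apply/funext => w; congr (_ * _); rewrite /sg_step; ring.
- by move=> k w; exact: iter_sg_step_bound.
- by move=> w; exact: cvg_iter_sg_step.
Qed.

(** For large k the argument (v j - t) / (k + 1) lies near 0, where its sine has
    its sign. *)
Let mult_sg j t : multiplier (fun w => Num.sg (v w j 0 - t)).
Proof.
pose a k : 'cV[K]_m := k.+1%:R^-1 *: delta_mx j 0.
apply: (@mult_cvg (fun k w =>
    Num.sg (sin (((a k)^T *m v w) 0 0 + - t / k.+1%:R))) _ 1).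
- by move=> k; exact: mult_sg_sin.
- by move=> k w; rewrite normr_sg; case: (_ != _).
move=> w; have aE k : ((a k)^T *m v w) 0 0 + - t / k.+1%:R =
    (v w j 0 - t) / k.+1%:R.
  rewrite /a linearZ/= -scalemxAl mxE trmx_delta -rowE mxE mulrDl.
  by rewrite (mulrC (v w j 0)).
under eq_fun do rewrite aE; move: (v w j 0 - t) => {aE}.
move=> y; apply: cvg_near_cst.
have sgE k : Num.sg (sin (y / k.+1%:R)) = Num.sg (sin_dilate k y).
  by rewrite /sin_dilate sgrM (gtr0_sg (_ : 0 < k.+1%:R)) ?mul1r ?ltr0n.
have [y0|y0|->] := ltgtP y 0.
- have : \forall k \near \oo, sin_dilate k y < 0.
    by apply: cvgr_lt y0; exact: cvg_sin_dilate.
  apply: filterS => k ky.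
  by rewrite sgE !ltr0_sg.
- have : \forall k \near \oo, 0 < sin_dilate k y.
    by apply: cvgr_gt y0; exact: cvg_sin_dilate.
  apply: filterS => k ky.
  by rewrite sgE !gtr0_sg.
- by apply: nearW => k; rewrite mul0r sin0.
Qed.

(** As multipliers form an algebra closed under bounded limits, the events with
    a multiplier as indicator form a sigma-algebra, not just a pi-system or a
    Dynkin system. *)
Let detset : set (set T) :=
  [set A | measurable A /\ multiplier (\1_A : T -> K)].

Let sigma_algebra_detset : sigma_algebra setT detset.
Proof.
split=> [|A [mA tA]|F SF].
- by split=> //; rewrite indic0; exact: mult_cst.
- rewrite setTD; split; first exact: measurableC.
  rewrite (_ : \1_ _ = fun w => 1 + (-1) * \1_A w :> K).
    by apply: multD; [exact: mult_cst|apply: multM; [exact: mult_cst|]].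
  apply/funext => w; rewrite indicC indicE; case: (_ \in _) => /=; ring.
split; first by apply: bigcup_measurable => k _; case: (SF k).
pose U k := \bigcup_(i < k) F i.
apply: (@mult_cvg (fun k => \1_(U k)) _ 1).
- elim=> [|k ih]; first by rewrite /U bigcup_mkord big_ord0 indic0;
    exact: mult_cst.
  rewrite (_ : \1_ _ =
    fun w => \1_(U k) w + \1_(F k) w * (1 + (-1) * \1_(U k) w) :> K).
    apply: multD => //; apply: multM; first by case: (SF k).
    by apply: multD; [exact: mult_cst|apply: multM; [exact: mult_cst|]].
  apply/funext => w; rewrite /U !bigcup_mkord big_ord_recr/= !indicE in_setU.
  by case: (_ \in _) => /=; case: (_ \in _) => /=; ring.
- by move=> k w; rewrite indicE; case: (_ \in _); rewrite ?normr1 ?normr0.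
move=> w; apply: cvg_near_cst; rewrite indicE.
have [|wF] := boolP (w \in _).
  rewrite inE => -[i _ Fi]; exists i.+1 => // k /= ik.
  by rewrite indicE mem_set//; exists i.
apply: nearW => k; rewrite indicE memNset//; move: wF; rewrite notin_setE.
by apply: contra_not => -[i _ Fi]; exists i.
Qed.

(** The uniqueness theorem for characteristic functions, for the signed measure
    with density e: if e is orthogonal to every cosine of a linear functional
    of v, then it is orthogonal to every event that depends on v. *)
Lemma mean_indic_eq0 B : measurable B -> mean P (fun w => e w * \1_B (v w)) = 0.
Proof.
move=> mB; have [_ [_ /(_ _ testfun1) [_ /(_ 0 0)]]] : detset (v @^-1` B).
  apply: (preimage_sigma_algebra sigma_algebra_detset _ mB).
  move=> _ [[j z] _ [A mA <-]] /=; rewrite setTI (ord1 z) -comp_preimage.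
  move: mA; rewrite [measurable]RGenOInfty.measurableE.
  apply: (preimage_sigma_algebra sigma_algebra_detset).
  move=> _ [t ->]; split.
    by rewrite -[X in measurable X]setTI; apply: mv => //;
      exact: measurable_itv.
  have ms := mult_sg j t.
  (* The polynomial s (1 + s) / 2 maps the signs -1, 0, 1 to 0, 0, 1. *)
  rewrite (_ : \1_ _ = fun w => Num.sg (v w j 0 - t) *
     ((1 + Num.sg (v w j 0 - t)) * 2^-1)).
    by apply: multM => //; apply: multM; [apply: multD => //|]; exact: mult_cst.
  apply/funext => w; rewrite indicE.
  have [H|H] := boolP (w \in _); move: H;
    rewrite ?inE ?notin_setE/= in_itv/= andbT.
    by move=> H; rewrite gtr0_sg ?subr_gt0//; field.
  move/negP; rewrite -leNgt le_eqVlt => /predU1P[->|H].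
    by rewrite subrr sgr0; field.
  by rewrite ltr0_sg ?subr_lt0//; field.
rewrite /cosv; under eq_fun do rewrite mul1r trmx0 mul0mx mxE addr0 cos0 mulr1.
by [].
Qed.

End CosineDetermining.
(** * The characteristic function of a Gaussian variable *)

Section NormalLaw.
Context (d : measure_display) (T : measurableType d) (K : realType)
  (P : probability T K).
Local Notation lam := (@lebesgue_measure K).

Let integral_normal_prob (m s : K) (f : K -> K) (M : K) :
  measurable_fun setT f ->
  (forall y, `|f y| <= M) ->
  (\int[normal_prob m s]_y (f y)%:E =
   \int[lam]_y (f y * normal_pdf m s y)%:E)%E.
Proof.
move=> mf fM.
have nf : L1 (normal_prob m s) f by refine (L1_bounded (normal_prob m s) mf fM).
rewrite -(Radon_Nikodym_change_of_variables (normal_prob_dominates m s))//.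
under [RHS]eq_integral do rewrite EFinM.
apply: ae_eq_integral => //.
- apply: emeasurable_funM; first exact/measurable_EFinP.
  apply: (measurable_int lam).
  by apply: Radon_Nikodym_integrable; exact: normal_prob_dominates.
- apply: emeasurable_funM; first exact/measurable_EFinP.
  by apply/measurable_EFinP; exact: measurable_normal_pdf.
apply: ae_eqe_mul2l => /=.
rewrite Radon_NikodymE//=; first exact: normal_prob_dominates.
move=> dom; case: cid => /= h [h1 h2 h3].
apply: integral_ae_eq => //=.
- by apply/measurable_EFinP; exact: measurable_normal_pdf.
- by move=> E _ mE; rewrite -h3.
Qed.

Lemma mean_law (X : T -> K) (nu : probability (measurableTypeR K) K)
    (f : K -> K) :
  measurable_fun setT X -> (forall A, measurable A -> P (X @^-1` A) = nu A) ->
  measurable_fun setT f -> L1 P (f \o X) -> mean P (f \o X) = mean nu f.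
Proof.
move=> mX law mf lf.
pose mX' := @isMeasurableFun.Build _ _ T (measurableTypeR K) X mX.
pose X' : {mfun T >-> measurableTypeR K} :=
  MeasurableFun.Pack (MeasurableFun.Class mX').
have mf' : measurable_fun [set: measurableTypeR K] (EFin \o f).
  by apply/measurable_EFinP; exact: mf.
rewrite /mean /Rintegral; congr fine.
rewrite -(@integral_distribution _ _ _ (measurableTypeR K) _ _ X'
  (EFin \o f))//.
apply: (@eq_measure_integral _ (measurableTypeR K) K setT nu
    (distribution P X')) => A mA _.
exact: law.
Qed.

Lemma mean_normal_law (X : T -> K) (m s : K) (f : K -> K) (M : K) :
  measurable_fun setT X ->
  (forall A, measurable A -> P (X @^-1` A) = normal_prob m s A) ->
  measurable_fun setT f -> (forall y, `|f y| <= M) ->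
  mean P (fun w => f (X w)) = \int[lam]_y (f y * normal_pdf m s y).
Proof.
move=> mX law mf fM; rewrite (mean_law (nu := normal_prob m s) mX law mf).
  by rewrite /mean /Rintegral (integral_normal_prob _ _ mf fM).
by apply: (@L1_bounded _ _ _ _ _ M) => [|w];
  [exact: measurableT_comp|exact: fM].
Qed.

End NormalLaw.

Section NormalStein.
Context (K : realType).
Variables (m s : K).
Hypothesis s0 : s != 0.
Local Notation lam := (@lebesgue_measure K).

Lemma is_derive_normal_pdf (y : K) :
  is_derive y 1 (normal_pdf m s) (- ((y - m) / s ^+ 2) * normal_pdf m s y).
Proof.
rewrite normal_pdfE//.
have -> : (fun x => normal_peak s * normal_fun m s x) =
    normal_peak s \*: (expR \o (fun x => - (x - m) ^+ 2 / (s ^+ 2 *+ 2))).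
  by apply/funext => x.
apply: is_derive_eq.
rewrite /= /normal_fun -[LHS]/(normal_peak s * _).
rewrite /GRing.scale/=; field; exact: s0.
Qed.

(** From exp z >= 1 + z; only the convergence to 0 matters. *)
Lemma normal_pdf_tail (k : nat) (y : K) : `|y - m| = k.+1%:R ->
  normal_pdf m s y <= normal_peak s * (2 * s ^+ 2) / k.+1%:R.
Proof.
move=> yk; rewrite normal_pdfE// -mulrA ler_wpM2l ?normal_peak_ge0//.
have s2 : 0 < s ^+ 2 by rewrite exprn_even_gt0.
rewrite /normal_fun -(real_normK (num_real (y - m))) yk mulNr expRN.
have c0 : 0 < 2 * s ^+ 2 / k.+1%:R by apply: divr_gt0 => //; apply: mulr_gt0.
rewrite invf_ple ?posrE ?expR_gt0//.
apply: le_trans (expR_ge1Dx _); rewrite invf_div.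
set q : K := k.+1%:R.
have q1 : 1 <= q by rewrite ler1n.
rewrite (_ : q ^+ 2 / (s ^+ 2 *+ 2) = q * (q / (2 * s ^+ 2))); last first.
  by field; exact: s0.
have : 0 <= q / (2 * s ^+ 2) by apply: divr_ge0;
  [exact: ler0n|apply: mulr_ge0 => //; exact: ltW].
nra.
Qed.

(** The derivative of stein_primitive, divided by the normal density. *)
Definition stein_fun (t b y : K) : K :=
  (y - m) * sin (t * y + b) - s ^+ 2 * (t * cos (t * y + b)).

Definition stein_primitive (t b y : K) : K :=
  - (s ^+ 2 * (normal_pdf m s y * sin (t * y + b))).

Let is_derive_primitive (t b y : K) : is_derive y 1 (stein_primitive t b)
  (stein_fun t b y * normal_pdf m s y).
Proof.
have dp := is_derive_normal_pdf y.
have dl : is_derive y 1 (fun z => t * z + b) t.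
  rewrite (_ : (fun z => t * z + b) = t \*: id + cst b); last exact/funext.
  by apply: is_derive_eq; rewrite /GRing.scale/= mulr1 addr0.
have ds : is_derive y 1 (sin \o (fun z => t * z + b)) (cos (t * y + b) * t).
  exact: is_derive1_comp.
rewrite (_ : stein_primitive t b =
  (- s ^+ 2) \*: (normal_pdf m s * (sin \o (fun z => t * z + b)))); last first.
  by apply/funext => z; rewrite /stein_primitive -mulNr.
apply: is_derive_eq.
by rewrite /stein_fun /GRing.scale/=; field; exact: s0.
Qed.

Lemma normal_primitive (t b : K) (k : nat) :
  (\int[lam]_(y in `[(m - k.+1%:R)%R, (m + k.+1%:R)%R])
     (stein_fun t b y * normal_pdf m s y)%:E =
   (stein_primitive t b (m + k.+1%:R))%:E -
     (stein_primitive t b (m - k.+1%:R))%:E)%E.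
Proof.
have q0 : 0 < k.+1%:R :> K by rewrite ltr0n.
have cf (f : K -> K) (g : K -> K) : (forall y : K, is_derive y 1 f (g y)) ->
  continuous f.
  move=> fg y; apply/differentiable_continuous/derivable1_diffP.
  by have := fg y; case.
have cp : continuous (stein_primitive t b) by apply: cf;
  exact: is_derive_primitive.
apply: continuous_FTC2.
- by rewrite ltrD2l; lra.
- apply: continuous_subspaceT => y; apply: cvgM.
    apply: cvgB.
      apply: cvgM; first by apply: cvgB; [exact: cvg_id|exact: cvg_cst].
      apply: (cvg_comp _ sin); last exact: continuous_sin.
      by apply: cvgD;
        [apply: cvgM; [exact: cvg_cst|exact: cvg_id]|exact: cvg_cst].
    apply: cvgM; first exact: cvg_cst.
    apply: cvgM; first exact: cvg_cst.
    apply: (cvg_comp _ cos); last exact: continuous_cos.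
    by apply: cvgD;
      [apply: cvgM; [exact: cvg_cst|exact: cvg_id]|exact: cvg_cst].
  exact: continuous_normal_pdf.
- split=> [y _||].
  + by have := is_derive_primitive t b y; case.
  + exact/cvg_at_right_filter/cp.
  + exact/cvg_at_left_filter/cp.
- by move=> y _; rewrite derive1E; apply: derive_val.
Qed.

Lemma primitive_tail (t b : K) (k : nat) (y : K) : `|y - m| = k.+1%:R ->
  `|stein_primitive t b y| <= s ^+ 2 * (normal_peak s * (2 * s ^+ 2) / k.+1%:R).
Proof.
move=> yk; rewrite normrN normrM ger0_norm ?sqr_ge0// ler_wpM2l ?sqr_ge0//.
rewrite normrM -[leRHS]mulr1 ler_pM ?sin_max//.
by rewrite ger0_norm ?normal_pdf_ge0// normal_pdf_tail.
Qed.

End NormalStein.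

Section NormalRV.
Context (d : measure_display) (T : measurableType d) (K : realType)
  (P : probability T K).
Variables (X : T -> K) (m s : K).
Hypothesis s0 : s != 0.
Hypothesis mX : measurable_fun setT X.
Hypothesis law : forall A, measurable A -> P (X @^-1` A) = normal_prob m s A.
Hypothesis lX : L2 P X.

Let measurable_affine (t b : K) : measurable_fun setT (fun y : K => t * y + b).
Proof.
apply: measurable_funD; last exact: measurable_cst.
by apply: measurable_funM => //; exact: measurable_cst.
Qed.

Let measurable_sin_affine (t b : K) :
  measurable_fun setT (fun y : K => sin (t * y + b)).
Proof.
apply: (@measurableT_comp _ _ _ _ _ _ (@sin K)) => //.
exact: measurable_sin.
Qed.

Let measurable_cos_affine (t b : K) :
  measurable_fun setT (fun y : K => cos (t * y + b)).
Proof.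
apply: (@measurableT_comp _ _ _ _ _ _ (@cos K)) => //.
exact: measurable_cos.
Qed.

Let measurable_stein (t b : K) : measurable_fun setT (stein_fun m s t b).
Proof.
apply: measurable_funB.
  by apply: measurable_funM => //; exact: measurable_funB.
by apply: measurable_funM => //; exact: measurable_funM.
Qed.

Let stein_fun_le (t b y : K) :
  `|stein_fun m s t b y| <= `|y - m| + `|s ^+ 2 * t|.
Proof.
apply: le_trans (ler_normB _ _) _; apply: lerD.
  by rewrite normrM ler_piMr ?sin_max.
by rewrite mulrA normrM ler_piMr ?cos_max.
Qed.

(** The expectation is the limit of the expectations over the events
    |X - m| <= k + 1, which are differences of the values of stein_primitive at
    the two end points. *)
Let mean_stein_fun (t b : K) : mean P (fun w => stein_fun m s t b (X w)) = 0.
Proof.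
pose I k := `[m - k.+1%:R, m + k.+1%:R]%classic.
have mI k : measurable (I k) by exact: measurable_itv.
have m1 k : measurable_fun setT (\1_(I k) : K -> K) by exact: measurable_indic.
have XI (k : nat) (y : K) : (y \in I k) = (`|y - m| <= k.+1%:R).
  apply/idP/idP; rewrite ?inE /I/= in_itv/= ler_norml => /andP[? ?]; apply/andP;
    split; lra.
apply: (@cvg_mean_unique _ _ _ P
  (fun k w => stein_fun m s t b (X w) * \1_(I k) (X w))
   _ (fun w => `|X w - m| + `|s ^+ 2 * t|)).
- by move=> k; apply: measurable_funM; exact: measurableT_comp.
- move=> w; rewrite -[X in _ --> X]mulr1; apply: cvgM; first exact: cvg_cst.
  apply: cvg_near_cst; exists (Num.truncn `|X w - m|) => // k /= Hk.
  rewrite indicE XI (_ : _ <= _)//.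
  by rewrite (le_trans (ltW (truncnS_gt _)))// ler_nat.
- move=> k w; rewrite normrM indicE; apply: le_trans (stein_fun_le t b (X w)).
  by rewrite ler_piMr//; case: (_ \in _); rewrite ?normr1 ?normr0.
- by apply: L1D;
    [apply/L1_norm/L1B; [exact: L2_L1|exact: L1_cst]|exact: L1_cst].
have meanE k : mean P (fun w => stein_fun m s t b (X w) * \1_(I k) (X w)) =
    stein_primitive m s t b (m + k.+1%:R) - stein_primitive m s t b
      (m - k.+1%:R).
  rewrite (@mean_normal_law _ _ _ P X m s
    (fun y => stein_fun m s t b y * \1_(I k) y)
    (k.+1%:R + `|s ^+ 2 * t|))//.
  - rewrite /Rintegral;
      transitivity (fine ((stein_primitive m s t b (m + k.+1%:R))%:E -
       (stein_primitive m s t b (m - k.+1%:R))%:E)%E); last by [].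
    rewrite -normal_primitive//; congr fine.
    rewrite [RHS]integral_mkcond; apply: eq_integral => y _.
    rewrite patchE indicE; case: ifP => yI; rewrite ?mulr1 ?mulr0 ?mul0r//.
  - by apply: measurable_funM.
  - move=> y; rewrite indicE; have [|_] := boolP (y \in I k).
      rewrite XI mulr1 => yk; apply: le_trans (stein_fun_le t b y) _.
      by rewrite lerD2r.
    by rewrite mulr0 normr0 addr_ge0.
pose C := 2 * (s ^+ 2 * (normal_peak s * (2 * s ^+ 2))).
apply/cvgrPdist_le => e e0.
have /cvgrPdist_le /(_ e e0) := @cvg_harmonic_scale K C.
apply: filterS => k; rewrite !sub0r !normrN meanE => Ck.
have q0 : 0 < k.+1%:R :> K by rewrite ltr0n.
apply: le_trans (ler_normB _ _) _; apply: le_trans Ck.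
have H1 : `|m + k.+1%:R - m| = k.+1%:R by rewrite addrC addKr ger0_norm.
have H2 : `|m - k.+1%:R - m| = k.+1%:R.
  by rewrite addrC addKr normrN ger0_norm.
apply: le_trans (lerD (primitive_tail s0 t b H1) (primitive_tail s0 t b H2)) _.
apply: le_trans (ler_norm _).
by rewrite le_eqVlt; apply/orP; left; apply/eqP; rewrite /C; field;
  rewrite gt_eqF.
Qed.

(** The Stein identity E ((X - m) f X) = s^2 E (f' X), for
    f y = sin (t y + b). *)
Lemma normal_stein (t b : K) :
  mean P (fun w => (X w - m) * sin (t * X w + b)) =
  s ^+ 2 * (t * mean P (fun w => cos (t * X w + b))).
Proof.
have mc : measurable_fun setT (fun w => cos (t * X w + b)).
  exact: (measurableT_comp (measurable_cos_affine t b)).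
have lc : L1 P (fun w => cos (t * X w + b)).
  by apply: (@L1_bounded _ _ _ P _ 1) => // w; exact: cos_max.
have := mean_stein_fun t b; rewrite /stein_fun meanB.
- by rewrite !meanZ//; [move/eqP; rewrite subr_eq0 => /eqP|exact: L1Z].
- apply: (@L1_mul_bounded _ _ _ _ _ _ 1).
  + by apply: L1B; [exact: L2_L1|exact: L1_cst].
  + exact: (measurableT_comp (measurable_sin_affine t b)).
  + by move=> w; exact: sin_max.
- by do 2 apply: L1Z.
Qed.

End NormalRV.

Lemma is_derive_quadratic (K : realType) (f : K -> K) (x D C : K) :
  (forall h, `|f (x + h) - f x - h * D| <= C * h ^+ 2) -> is_derive x 1 f D.
Proof.
move=> fD.
have C0 : 0 <= C by have := fD 1; rewrite expr1n mulr1; apply: le_trans.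
have cv : h^-1 *: ((f \o shift x) (h *: 1) - f x) @[h --> 0^'] --> D.
  apply/cvgrPdist_le => e e0.
  have eC : 0 < e / (C + 1) by apply: divr_gt0 => //; exact: ltr_wpDl.
  near=> h.
  have h0 : h != 0 by near: h; exact: nbhs_dnbhs_neq.
  have hC : `|h| <= e / (C + 1) by near: h; exact: dnbhs0_le.
  have {}hC : C * `|h| <= e.
    move: hC; rewrite ler_pdivlMr ?ltr_wpDl//; apply: le_trans.
    by rewrite mulrC ler_wpM2l// lerDl.
  rewrite /GRing.scale/= mulr1 (addrC h).
  rewrite (_ : _ - _ = - (h^-1 * (f (x + h) - f x - h * D))); last by field.
  rewrite normrN normrM normfV; apply: le_trans hC.
  rewrite ler_pdivrMl ?normr_gt0//; apply: le_trans (fD h) _.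
  by rewrite -(real_normK (num_real h)) expr2 mulrCA.
split; first by apply/cvg_ex; exists D.
exact: cvg_lim.
Unshelve. all: by end_near. Qed.

Section Characteristic.
Context (d : measure_display) (T : measurableType d) (K : realType)
  (P : probability T K).
Implicit Types (X Y : T -> K).

Lemma L1_cos X : measurable_fun setT X -> L1 P (fun w => cos (X w)).
Proof.
move=> mX; apply: (@L1_bounded _ _ _ P _ 1) => [|w]; last exact: cos_max.
apply: (measurableT_comp _ mX).
exact: measurable_cos.
Qed.

Lemma L1_mul_sin X Y : L1 P Y -> measurable_fun setT X ->
  L1 P (fun w => Y w * sin (X w)).
Proof.
move=> lY mX; apply: (@L1_mul_bounded _ _ _ P _ _ 1) => // [|w];
  last exact: sin_max.
apply: (measurableT_comp _ mX).
exact: measurable_sin.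
Qed.

(** The expansion of s |-> E cos (Y + s X) to the first order, with a remainder
    that needs only the second moment of X. *)
Lemma mean_cos_expansion X Y (h : K) : measurable_fun setT Y -> L2 P X ->
  `|mean P (fun w => cos (Y w + h * X w)) - mean P (fun w => cos (Y w))
    - h * (- mean P (fun w => X w * sin (Y w)))| <=
  mean P (fun w => X w ^+ 2) * h ^+ 2.
Proof.
move=> mY lX; have mX := L2_measurable lX; have l1X := L2_L1 lX.
have lXX : L1 P (fun w => X w ^+ 2) by case: lX.
have lc1 : L1 P (fun w => cos (Y w + h * X w)).
  by apply: L1_cos; apply: measurable_funD => //; apply: measurable_funM => //;
    exact: measurable_cst.
have lc2 := L1_cos mY.
have ls : L1 P (fun w => X w * sin (Y w)) by exact: L1_mul_sin.
rewrite mulrN opprK [leRHS]mulrC -[leRHS]meanZ// -meanZ// -meanB// -meanD//;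
  last 2 first.
- exact: L1B.
- exact: L1Z.
apply: ler_norm_mean => [||w].
- by apply: L1D; [exact: L1B|exact: L1Z].
- exact: L1Z.
by rewrite mulrA -exprMn; exact: cos_expansion.
Qed.

(** By the Stein identity, psi t = E cos (t X + b) solves psi' = - s^2 t psi,
    so psi t exp (s^2 t^2 / 2) is constant. The same identity identifies the
    parameters of the law: at t = 0 it gives m = E X, and divided by t with
    b = 0 it gives s^2 = E X^2 as t tends to 0. *)
Lemma normal_cos (X : T -> K) (m s : K) : s != 0 -> L2 P X -> mean P X = 0 ->
  (forall A, measurable A -> P (X @^-1` A) = normal_prob m s A) ->
  forall b, mean P (fun w => cos (X w + b)) =
    expR (- mean P (fun w => X w ^+ 2) / 2) * cos b.
Proof.
move=> s0 lX X0 law; have mX := L2_measurable lX; have l1X := L2_L1 lX.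
have stein := normal_stein s0 mX law lX.
have m0 : m = 0.
  (* sin (0 X + pi / 2) = 1 *)
  have := stein 0 (pi / 2); rewrite mul0r mulr0.
  under eq_fun do rewrite mul0r add0r sin_pihalf mulr1.
  rewrite meanB//; last exact: L1_cst.
  by rewrite X0 mean_cst sub0r => /eqP; rewrite oppr_eq0 => /eqP.
have mXt (t b : K) : measurable_fun setT (fun w => t * X w + b).
  apply: measurable_funD; last exact: measurable_cst.
  by apply: measurable_funM => //; exact: measurable_cst.
pose psi b t := mean P (fun w => cos (t * X w + b)).
have dpsi b (t : K) : is_derive t 1 (psi b) (- (s ^+ 2 * t * psi b t)).
  apply: (@is_derive_quadratic _ _ _ _ (mean P (fun w => X w ^+ 2))) => h.
  have := mean_cos_expansion h (mXt t b) lX.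
  have <- : (fun w => cos ((t + h) * X w + b)) =
      (fun w => cos (t * X w + b + h * X w)).
    by apply/funext => w; rewrite mulrDl addrAC.
  have -> : mean P (fun w => X w * sin (t * X w + b)) = s ^+ 2 * (t * psi b t).
    rewrite -stein m0; congr mean; apply/funext => w; by rewrite subr0.
  by rewrite /psi mulrA.
have psiE b t : psi b t = expR (- (s ^+ 2 * t ^+ 2 / 2)) * cos b.
  pose phi (u : K) := psi b u * expR (s ^+ 2 / 2 * u ^+ 2).
  have : phi t = phi 0.
    apply: is_derive_0_is_cst => u.
    have dq : is_derive u 1 (fun z => s ^+ 2 / 2 * z ^+ 2) (s ^+ 2 * u).
      rewrite (_ : (fun z => _) = (s ^+ 2 / 2) \*: (id ^+ 2));
        last exact/funext.
      by apply: is_derive_eq; rewrite /GRing.scale/=; field.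
    have de : is_derive u 1 (expR \o (fun z => s ^+ 2 / 2 * z ^+ 2))
       (expR (s ^+ 2 / 2 * u ^+ 2) * (s ^+ 2 * u)) by exact: is_derive1_comp.
    rewrite (_ : phi = psi b * (expR \o (fun z => s ^+ 2 / 2 * z ^+ 2)))//.
    by apply: is_derive_eq; rewrite /GRing.scale/=; ring.
  have -> : phi 0 = cos b.
    rewrite /phi expr0n mulr0 expR0 mulr1 /psi.
    by under eq_fun do rewrite mul0r add0r; rewrite mean_cst.
  rewrite /phi => phiE; rewrite -phiE mulrCA -expRD.
  by rewrite (_ : _ + _ = 0) ?expR0 ?mulr1//; field.
have s2E : mean P (fun w => X w ^+ 2) = s ^+ 2.
  apply: (@cvg_mean_unique _ _ _ P (fun k w => X w * sin_dilate k (X w)) _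
     (fun w => X w ^+ 2)).
  - move=> k; apply: measurable_funM => //; apply: measurable_funM;
      first exact: measurable_cst.
    apply: (@measurableT_comp _ _ _ _ _ _ (@sin K)).
      exact: measurable_sin.
    by apply: measurable_funM => //; exact: measurable_cst.
  - by move=> w; rewrite expr2; apply: cvgM;
      [exact: cvg_cst|exact: cvg_sin_dilate].
  - move=> k w; rewrite normrM -(real_normK (num_real (X w))) expr2 ler_wpM2l//.
    exact: sin_dilate_le.
  - by case: lX.
  have E k : mean P (fun w => X w * sin_dilate k (X w)) =
    s ^+ 2 * psi 0 (k.+1%:R^-1).
    have k0 : k.+1%:R != 0 :> K by rewrite pnatr_eq0.
    under eq_fun do rewrite /sin_dilate mulrCA (mulrC _ _^-1) -[_^-1 * _]addr0.
    rewrite meanZ; last exact: L1_mul_sin.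
    have := stein k.+1%:R^-1 0; rewrite m0.
    have -> : (fun w => (X w - 0) * sin (k.+1%:R^-1 * X w + 0)) =
      (fun w => X w * sin (k.+1%:R^-1 * X w + 0)).
      by apply/funext => w; rewrite subr0.
    by move=> ->; rewrite mulrCA (mulrA k.+1%:R) divff// mul1r.
  have [||||_] := @cvg_mean _ _ _ P (fun k w => cos (k.+1%:R^-1 * X w + 0))
      (fun=> cos 0) (fun=> 1).
  - move=> k; apply: (@measurableT_comp _ _ _ _ _ _ (@cos K)) => //.
    exact: measurable_cos.
  - move=> w; apply: (cvg_comp _ cos); last exact: continuous_cos.
    by under eq_fun do rewrite addr0 mulrC; exact: cvg_harmonic_scale.
  - by move=> k w; exact: cos_max.
  - exact: L1_cst.
  rewrite mean_cst cos0 => L.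
  have : s ^+ 2 * psi 0 k.+1%:R^-1 @[k --> \oo] --> s ^+ 2 * 1.
    by apply: cvgM; [exact: cvg_cst|exact: L].
  rewrite mulr1; apply: cvg_trans.
  by apply: near_eq_cvg; apply: nearW => k; rewrite E.
move=> b; have := psiE b 1; rewrite /psi s2E.
under eq_fun do rewrite mul1r.
by rewrite expr1n mulr1 mulNr.
Qed.

Lemma gaussian_cos X : L2 P X -> mean P X = 0 ->
  (exists m s : K, forall A, measurable A ->
    P (X @^-1` A) = gaussian_law m s A) ->
  forall b, mean P (fun w => cos (X w + b)) =
    expR (- mean P (fun w => X w ^+ 2) / 2) * cos b.
Proof.
move=> lX X0 [m [s law]]; have [s0|s0] := eqVneq s 0; last first.
  apply: (@normal_cos X m s) => // A mA.
  by rewrite law// /gaussian_law (negbTE s0).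
have mX := L2_measurable lX.
have dirac_mean (f : K -> K) : measurable_fun setT f -> L1 P (f \o X) ->
    mean P (f \o X) = f m.
  move=> mf lf; rewrite (@mean_law _ _ _ P X (\d_(m : measurableTypeR K)))//.
    rewrite /mean /Rintegral integral_dirac//; last exact/measurable_EFinP.
    by rewrite diracT mul1e.
  by move=> A mA; rewrite law// /gaussian_law s0 eqxx.
have m0 : m = 0.
  by rewrite -X0; apply/esym; apply: (dirac_mean id) => //; exact: L2_L1.
move=> b.
rewrite (dirac_mean (fun y => cos (y + b))).
- rewrite (dirac_mean (fun y => y ^+ 2)).
  + by rewrite m0 expr0n oppr0 mul0r expR0 mul1r add0r.
  + exact: measurable_funX.
  + by case: lX.
- apply: (@measurableT_comp _ _ _ _ _ _ (@cos K)).
    exact: measurable_cos.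
  by apply: measurable_funD.
- by apply: L1_cos; apply: measurable_funD.
Qed.

End Characteristic.

(** * Uncorrelated Gaussian variables *)

Section Uncorrelated.
Context (d : measure_display) (T : measurableType d) (K : realType)
  (P : probability T K).
Implicit Types (X Y G : T -> K).

(** The characteristic function of G is that of a centred Gaussian variable: the
    phases b = 0 and b = - pi / 2 give its real and imaginary parts. *)
Definition gaussian_cosine G := forall b : K,
  mean P (fun w => cos (G w + b)) =
    expR (- mean P (fun w => G w ^+ 2) / 2) * cos b.

(** As X and Y are uncorrelated, the variance of X + h Y is that of X plus
    O(h^2), and so E cos (X + h Y + b) = E cos (X + b) + O(h^2). On the other
    hand its derivative at h = 0 is - E (Y sin (X + b)), which must vanish. *)
Lemma uncorrelated_cos X Y : L2 P X -> L2 P Y ->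
  (forall h : K, gaussian_cosine (fun w => X w + h * Y w)) ->
  mean P (fun w => X w * Y w) = 0 ->
  forall b, mean P (fun w => Y w * cos (X w + b)) = 0.
Proof.
move=> lX lY gXY XY0 b.
have mX := L2_measurable lX; have mY := L2_measurable lY.
pose be := mean P (fun w => Y w ^+ 2); pose al := mean P (fun w => X w ^+ 2).
have be0 : 0 <= be by apply: mean_ge0 => w; exact: sqr_ge0.
have al0 : 0 <= al by apply: mean_ge0 => w; exact: sqr_ge0.
have l1XY := L2M lX lY.
have varE h : mean P (fun w => (X w + h * Y w) ^+ 2) = al + h ^+ 2 * be.
  rewrite (_ : (fun w => _) =
    fun w => X w ^+ 2 + (2 * h) * (X w * Y w) + h ^+ 2 * Y w ^+ 2).
    rewrite meanD ?meanD ?meanZ// ?XY0 ?mulr0 ?addr0//.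
    - by case: lY.
    - by case: lX.
    - exact: L1Z.
    - by apply: L1D; [case: lX|exact: L1Z].
    - by apply: L1Z; case: lY.
  by apply/funext => w; ring.
pose c := mean P (fun w => Y w * cos (X w + b)).
have cE : mean P (fun w => Y w * sin (X w + (b + pi / 2))) = c.
  by congr mean; apply/funext => w; rewrite addrA sinDpihalf.
have key (h : K) : `|h * c| <= (3 / 2 * be) * h ^+ 2.
  have mXb : measurable_fun setT (fun w => X w + (b + pi / 2)).
    by apply: measurable_funD => //; exact: measurable_cst.
  have := mean_cos_expansion h mXb lY; rewrite cE.
  have -> : (fun w => cos (X w + (b + pi / 2) + h * Y w)) =
      (fun w => cos (X w + h * Y w + (b + pi / 2))).
    by apply/funext => w; rewrite addrAC.
  rewrite gXY varE.
  have -> : mean P (fun w => cos (X w + (b + pi / 2))) =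
      expR (- al / 2) * cos (b + pi / 2).
    have := gXY 0 (b + pi / 2); rewrite varE expr0n mul0r addr0 => <-.
    by congr mean; apply/funext => w; rewrite mul0r addr0.
  rewrite -/be -mulrBl => H.
  pose u := h ^+ 2 * be / 2.
  have u0 : 0 <= u by rewrite /u divr_ge0// mulr_ge0// sqr_ge0.
  have e1 : expR (- (al + h ^+ 2 * be) / 2) = expR (- al / 2) * expR (- u).
    by rewrite -expRD; congr expR; rewrite /u; field.
  have ea : 0 < expR (- al / 2) <= 1.
    by rewrite expR_gt0 -expR0 ler_expR mulNr oppr_le0 divr_ge0.
  have eu1 : expR (- u) <= 1 by rewrite -[leRHS]expR0 ler_expR oppr_le0.
  have eu : 1 - u <= expR (- u) by exact: expR_ge1Dx.
  have dE : `|(expR (- (al + h ^+ 2 * be) / 2) - expR (- al / 2)) *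
      cos (b + pi / 2)| <= u.
    rewrite normrM; apply: (@le_trans _ _ (u * 1)); last by rewrite mulr1.
    apply: ler_pM => //; last exact: cos_max.
    case/andP: ea => ea0 ea1.
    rewrite e1 -[X in _ - X]mulr1 -mulrBr normrM gtr0_norm// -[leRHS]mul1r.
    apply: ler_pM => //.
    by rewrite ler_norml; apply/andP; split; lra.
  rewrite mulrN opprK in H.
  set D := (_ - _) * _ in H dE.
  rewrite (_ : h * c = (D + h * c) - D); last by ring.
  apply: le_trans (ler_normB _ _) _; apply: le_trans (lerD H dE) _.
  by rewrite le_eqVlt; apply/orP; left; apply/eqP; rewrite /u; field.
apply/eqP; rewrite -normr_le0; apply/ler_addgt0Pr => e e0; rewrite add0r.
(* Any positive h with 3 / 2 be h <= e would do. *)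
pose h := e / (3 / 2 * be + 1).
have D0 : 0 < 3 / 2 * be + 1 by apply: ltr_wpDl => //; apply: mulr_ge0.
have h0 : 0 < h by exact: divr_gt0.
have := key h; rewrite normrM gtr0_norm// expr2 mulrA mulrC ler_pM2r//.
move=> /le_trans; apply.
rewrite /h mulrA ler_pdivrMr// mulrC ler_pM2l//; lra.
Qed.

End Uncorrelated.

(** * Sums of independent Gaussian variables *)

Section Independence.
Context (d : measure_display) (T : measurableType d) (K : realType)
  (P : probability T K) (I : choiceType) (E : I -> set (set T)).
Hypothesis mE : forall i A, E i A -> measurable A.
Hypothesis indep : mutually_independent P E.

Definition adapted (S : set (set T)) (F : T -> K) :=
  forall B : set K, measurable B -> S (F @^-1` B).

Let bounded_adapted i (F : T -> K) :=
  adapted (E i) F /\ exists M : K, forall w, `|F w| <= M.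

Let adapted_measurable i F : adapted (E i) F -> measurable_fun setT F.
Proof. by move=> aF _ B mB; rewrite setTI; exact/mE/aF. Qed.

(** Independence is a statement about events, so a product of random variables
    is reached from a product of indicators by replacing one factor at a
    time. *)
Let prod_rv (J1 J2 : seq I) (F : I -> T -> K) (A : I -> set T) (w : T) : K :=
  \prod_(j <- J1) F j w * \prod_(j <- J2) \1_(A j) w.

Let prod_rv_bounded J1 J2 F A :
  (forall j, j \in J1 -> bounded_adapted j (F j)) ->
  (forall j, j \in J2 -> E j (A j)) ->
  measurable_fun setT (prod_rv J1 J2 F A) /\
  exists M : K, forall w, `|prod_rv J1 J2 F A w| <= M.
Proof.
move=> bF EA.
have [m1 [M1 b1]] : measurable_fun setT (fun w => \prod_(j <- J1) F j w) /\
    exists M : K, forall w, `|\prod_(j <- J1) F j w| <= M.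
  elim: J1 bF => [|j J ih] bF.
    under eq_fun do rewrite big_nil; split; first exact: measurable_cst.
    by exists 1 => w; rewrite big_nil normr1.
  have [aj [M jM]] := bF j (mem_head _ _).
  have [mJ [N JN]] := ih (fun i iJ => bF i (mem_behead (s := j :: J) iJ)).
  under eq_fun do rewrite big_cons; split.
    by apply: measurable_funM => //; exact: adapted_measurable aj.
  by exists (M * N) => w; rewrite big_cons normrM; exact: ler_pM.
have [m2 b2] : measurable_fun setT (fun w => \prod_(j <- J2) \1_(A j) w : K) /\
    forall w, `|\prod_(j <- J2) \1_(A j) w : K| <= 1.
  elim: J2 EA => [|j J ih] EA.
    under eq_fun do rewrite big_nil; split; first exact: measurable_cst.
    by move=> w; rewrite big_nil normr1.
  have mA := mE (EA j (mem_head _ _)).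
  have [mJ JN] := ih (fun i iJ => EA i (mem_behead (s := j :: J) iJ)).
  under eq_fun do rewrite big_cons; split.
    by apply: measurable_funM => //; exact: measurable_indic.
  move=> w; rewrite big_cons normrM -[leRHS]mulr1; apply: ler_pM => //.
  by rewrite indicE; case: (_ \in _); rewrite ?normr1 ?normr0.
split; first exact: measurable_funM.
by exists (M1 * 1) => w; rewrite normrM; exact: ler_pM.
Qed.

(** For the first variable F j of J1, the induction hypothesis computes the
    expectation of the product W of the other factors times the indicator of
    any event depending on F j. It says that W - E W is orthogonal to these
    events, so it is orthogonal to F j. *)
Let mean_prod_rv J1 : forall J2 F A, uniq (J1 ++ J2) ->
  (forall j, j \in J1 -> bounded_adapted j (F j)) ->
  (forall j, j \in J2 -> E j (A j)) ->
  mean P (prod_rv J1 J2 F A) =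
  \prod_(j <- J1) mean P (F j) * \prod_(j <- J2) fine (P (A j)).
Proof.
elim: J1 => [|j J1 ih] J2 F A uJ bF EA.
  rewrite big_nil mul1r.
  have -> : \prod_(j <- J2) fine (P (A j)) =
    fine (P (\bigcap_(j in [set` J2]) A j)).
    rewrite indep//; elim: J2 {uJ} EA => [|i J2 ih] EA;
      first by rewrite !big_nil.
    rewrite !big_cons fineM ?ih//.
    - by move=> k kJ; apply: EA; rewrite inE kJ orbT.
    - exact: fin_num_measure (mE (EA _ (mem_head _ _))).
    - rewrite big_seq; apply: (big_ind (fun z => z \is a fin_num)) => //.
        by move=> *; exact: fin_numM.
      by move=> k kJ; apply: fin_num_measure; apply: (@mE k); apply: EA;
        rewrite inE kJ orbT.
  have -> : prod_rv [::] J2 F A = \1_(\bigcap_(j in [set` J2]) A j).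
    apply/funext => w; rewrite /prod_rv big_nil mul1r bigcap_seq.
    elim: J2 {uJ EA} => [|i J2 ih]; first by rewrite !big_nil indicT.
    by rewrite !big_cons ih indicI.
  rewrite /mean /Rintegral integral_indic// ?setIT//.
  rewrite bigcap_seq big_seq.
  by apply: bigsetI_measurable => i iJ; apply: (@mE i); exact: EA.
move: uJ; rewrite cat_cons cons_uniq mem_cat negb_or =>
  /andP[/andP[jJ1 jJ2] uJ].
have bF' k : k \in J1 -> bounded_adapted k (F k) by move=> kJ; apply: bF;
  rewrite inE kJ orbT.
have [aj [M jM]] := bF j (mem_head _ _).
have mFj := adapted_measurable aj.
have [mW [N WN]] := prod_rv_bounded bF' EA.
set W := prod_rv J1 J2 F A in mW WN.
have lW : L1 P W by apply: (@L1_bounded _ _ _ P _ N).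
pose c := mean P W.
have cE : c = \prod_(j <- J1) mean P (F j) * \prod_(j <- J2) fine (P (A j)).
  exact: ih.
have lWc : L1 P (fun w => W w - c) by apply: L1B => //; exact: L1_cst.
have lF : L1 P (F j) by apply: (@L1_bounded _ _ _ P _ M).
have lWF : L1 P (fun w => W w * F j w) by exact (L1_mul_bounded lW mFj jM).
have : mean P (fun w => (W w - c) * idfun (F j w)) = 0.
  apply: mean_mul_eq0 => //.
  - exact: measurable_id.
  - exact (L1_mul_bounded lWc mFj jM).
  move=> B mB; have EB : E j (F j @^-1` B) by exact: aj.
  pose A' i := if i == j then F j @^-1` B else A i.
  have l1 : L1 P (\1_(F j @^-1` B) : T -> K).
    apply: (@L1_bounded _ _ _ P _ 1); first exact: measurable_indic (mE EB).
    by move=> w; rewrite indicE; case: (_ \in _); rewrite ?normr1 ?normr0.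
  rewrite (_ : (fun w => _) =
      (fun w => prod_rv J1 (j :: J2) F A' w - c * \1_(F j @^-1` B) w)).
    have EA' i : i \in j :: J2 -> E i (A' i).
      by rewrite inE /A'; case: eqVneq => [->//|_ /=]; exact: EA.
    have [mW' [N' WN']] := prod_rv_bounded bF' EA'.
    rewrite meanB ?meanZ//; last 2 first.
    + by apply: (@L1_bounded _ _ _ P _ N').
    + exact: L1Z.
    have uJ' : uniq (J1 ++ j :: J2).
      by rewrite -(cat1s j) uniq_catCA /= mem_cat negb_or jJ1 jJ2.
    rewrite ih// big_cons /A' eqxx.
    rewrite [X in _ * (_ * X) - _](_ : _ = \prod_(i <- J2) fine (P (A i))).
      rewrite cE /mean /Rintegral integral_indic ?setIT//; last exact: mE EB.
      by rewrite mulrCA mulrC subrr.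
    by rewrite big_seq [RHS]big_seq; apply: eq_bigr => i iJ;
      case: eqVneq iJ => // ->; rewrite (negbTE jJ2).
  apply/funext => w; rewrite mulrBl; congr (_ - _).
  rewrite /W /prod_rv big_cons /A' eqxx mulrCA mulrC; congr (_ * _).
    by congr (_ * _); rewrite big_seq [RHS]big_seq; apply: eq_bigr => i iJ;
      case: eqVneq iJ => // ->; rewrite (negbTE jJ2).
rewrite /=; under eq_fun do rewrite mulrBl; rewrite meanB//; last exact: L1Z.
rewrite meanZ// => /eqP; rewrite subr_eq0 => /eqP WF.
rewrite big_cons -mulrA -cE mulrC -WF; congr mean.
by apply/funext => w; rewrite /W /prod_rv big_cons -mulrA mulrC.
Qed.

Lemma independent_prod J (F : I -> T -> K) : uniq J ->
  (forall j, j \in J -> bounded_adapted j (F j)) ->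
  mean P (fun w => \prod_(j <- J) F j w) = \prod_(j <- J) mean P (F j).
Proof.
move=> uJ bF; have := @mean_prod_rv J [::] F (fun=> setT).
rewrite cats0 big_nil mulr1 => <- //; congr mean.
by apply/funext => w; rewrite /prod_rv big_nil mulr1.
Qed.

Variable Y : I -> T -> K.
Hypothesis aY : forall i, adapted (E i) (Y i).
Hypothesis lY : forall i, L2 P (Y i).
Hypothesis Y0 : forall i, mean P (Y i) = 0.
Hypothesis gY : forall i, gaussian_cosine P (Y i).

Lemma adapted_comp (S : set (set T)) (F : T -> K) (g : K -> K) :
  adapted S F -> measurable_fun setT g -> adapted S (g \o F).
Proof.
move=> aF mg B mB; rewrite comp_preimage; apply: aF.
by rewrite -[X in measurable X]setTI; exact: mg.
Qed.

(** The product rule is available for bounded variables; sin_dilate truncates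
    Y i and Y j. *)
Lemma independent_uncorrelated i j : i != j ->
  mean P (fun w => Y i w * Y j w) = 0.
Proof.
move=> ij.
have msd k : measurable_fun setT (@sin_dilate K k).
  apply: measurable_funM; first exact: measurable_cst.
  apply: (@measurableT_comp _ _ _ _ _ _ (@sin K)).
    exact: measurable_sin.
  by apply: measurable_funM => //; exact: measurable_cst.
have mY i' : measurable_fun setT (Y i') by exact: L2_measurable.
apply: (@cvg_mean_unique _ _ _ P
  (fun k w => sin_dilate k (Y i w) * sin_dilate k (Y j w)) _
  (fun w => `|Y i w * Y j w|)).
- by move=> k; apply: measurable_funM; exact: measurableT_comp.
- by move=> w; apply: cvgM; exact: cvg_sin_dilate.
- by move=> k w; rewrite normrM [leRHS]normrM; apply: ler_pM => //;
    exact: sin_dilate_le.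
- by apply: L1_norm; exact: L2M.
have E0 i' : mean P (fun w => sin_dilate k (Y i' w)) @[k --> \oo] --> (0 : K).
  have [||||_ L] := @cvg_mean _ _ _ P (fun k w => sin_dilate k (Y i' w))
    (Y i') (fun w => `|Y i' w|).
  - by move=> k; exact: measurableT_comp.
  - by move=> w; exact: cvg_sin_dilate.
  - by move=> k w; exact: sin_dilate_le.
  - by apply: L1_norm; exact: L2_L1.
  by rewrite Y0 in L.
have : mean P (fun w => sin_dilate k (Y i w)) *
    mean P (fun w => sin_dilate k (Y j w)) @[k --> \oo] --> (0 * 0 : K).
  by apply: cvgM; exact: E0.
rewrite mulr0; apply: cvg_trans.
apply: near_eq_cvg; apply: nearW => k.
have := @independent_prod [:: i; j] (fun l w => sin_dilate k (Y l w)).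
rewrite /= inE ij => /(_ isT); rewrite !big_cons !big_nil mulr1 => <-.
  by congr mean; apply/funext => w; rewrite !big_cons !big_nil mulr1.
move=> l _; split; first exact: adapted_comp.
exists `|k.+1%:R| => w; rewrite normrM -[leRHS]mulr1.
by rewrite ler_wpM2l// sin_max.
Qed.

Lemma L2_sum_rv (J : seq I) : L2 P (fun w => \sum_(j <- J) Y j w).
Proof. exact: L2_sum. Qed.

Lemma mean_sqr_sum (J : seq I) : uniq J ->
  mean P (fun w => (\sum_(j <- J) Y j w) ^+ 2) =
  \sum_(j <- J) mean P (fun w => Y j w ^+ 2).
Proof.
elim: J => [|i J ih].
  move=> _; rewrite big_nil -[RHS](mean_cst P); congr mean; apply/funext => w.
  by rewrite big_nil expr0n.
rewrite cons_uniq => /andP[iJ uJ]; rewrite big_cons -ih//.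
have lS := L2_sum_rv J.
rewrite (_ : (fun w => _) = fun w => Y i w ^+ 2 +
   2 * (\sum_(j <- J) Y i w * Y j w) + (\sum_(j <- J) Y j w) ^+ 2).
  have lYY : L1 P (fun w => \sum_(j <- J) Y i w * Y j w).
    by apply: L1_sum => j; exact: L2M.
  rewrite meanD ?meanD ?meanZ//; last 4 first.
  - by case: (lY i).
  - exact: L1Z.
  - by apply: L1D; [case: (lY i)|exact: L1Z].
  - by case: lS.
  rewrite mean_sum => [|j]; last exact: L2M.
  rewrite big_seq big1 ?mulr0 ?addr0// => j jJ.
  by apply: independent_uncorrelated; apply: contraNneq iJ => ->.
by apply/funext => w; rewrite big_cons -mulr_sumr; ring.
Qed.

(** The additional factors F make the induction work: the addition formula for
    the cosine splits off cos (Y i) and sin (Y i), which join these factors. *)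
Let cos_sum_prod J1 : forall J2 F (b : K), uniq (J1 ++ J2) ->
  (forall j, j \in J2 -> bounded_adapted j (F j)) ->
  mean P (fun w => cos (\sum_(j <- J1) Y j w + b) * \prod_(j <- J2) F j w) =
  expR (- (\sum_(j <- J1) mean P (fun w => Y j w ^+ 2)) / 2) * cos b *
  mean P (fun w => \prod_(j <- J2) F j w).
Proof.
have bprod J F : (forall j, j \in J -> bounded_adapted j (F j)) ->
    L1 P (fun w => \prod_(j <- J) F j w).
  move=> bF; have EA : forall j, j \in [::] -> E j setT by [].
  have [mW [M WM]] := @prod_rv_bounded J [::] F (fun=> setT) bF EA.
  rewrite (_ : (fun w => _) = prod_rv J [::] F (fun=> setT)).
    by apply: (@L1_bounded _ _ _ P _ M).
  by apply/funext => w; rewrite /prod_rv big_nil mulr1.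
elim: J1 => [|i J1 ih] J2 F b uJ bF.
  rewrite big_nil oppr0 mul0r expR0 mul1r -meanZ; last exact: bprod.
  by congr mean; apply/funext => w; rewrite big_nil add0r.
move: uJ; rewrite cat_cons cons_uniq mem_cat negb_or =>
  /andP[/andP[iJ1 iJ2] uJ].
have uJ' : uniq (J1 ++ i :: J2).
  by rewrite -(cat1s i) uniq_catCA /= mem_cat negb_or iJ1 iJ2.
have mY := L2_measurable (lY i).
have bcos (t : K) : bounded_adapted i (fun w => cos (Y i w + t)).
  split; last by exists 1 => w; exact: cos_max.
  apply: (@adapted_comp _ (Y i) (fun y => cos (y + t))) => //.
  apply: (@measurableT_comp _ _ _ _ _ _ (@cos K)).
    exact: measurable_cos.
  by apply: measurable_funD.
pose F' t j := if j == i then (fun w => cos (Y i w + t)) else F j.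
have bF' t j : j \in i :: J2 -> bounded_adapted j (F' t j).
  by rewrite inE /F'; case: eqVneq => [->//|_ /=]; exact: bF.
have FE t w : \prod_(j <- i :: J2) F' t j w =
    cos (Y i w + t) * \prod_(j <- J2) F j w.
  rewrite big_cons /F' eqxx; congr (_ * _).
  by rewrite big_seq [RHS]big_seq; apply: eq_bigr => k kJ;
    case: eqVneq kJ => // ->; rewrite (negbTE iJ2).
have mFE t : mean P (fun w => \prod_(j <- i :: J2) F' t j w) =
    expR (- mean P (fun w => Y i w ^+ 2) / 2) * cos t *
    mean P (fun w => \prod_(j <- J2) F j w).
  rewrite independent_prod//; last exact: bF'.
    rewrite big_cons {1}/F' eqxx (gY i t) independent_prod//; last first.
      by move: uJ; rewrite cat_uniq => /and3P[].
    congr (_ * _); rewrite big_seq [RHS]big_seq; apply: eq_bigr => k kJ.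
    by rewrite /F'; case: eqVneq kJ => // ->; rewrite (negbTE iJ2).
  by move: uJ'; rewrite cat_uniq => /and3P[].
rewrite (_ : (fun w => _) = fun w =>
    cos (\sum_(j <- J1) Y j w + b) * \prod_(j <- i :: J2) F' 0 j w +
    cos (\sum_(j <- J1) Y j w + (b + pi / 2)) * \prod_(j <- i :: J2) F'
      (- (pi / 2)) j w).
  have lterm t c : L1 P (fun w =>
      cos (\sum_(j <- J1) Y j w + c) * \prod_(j <- i :: J2) F' t j w).
    have ms : measurable_fun setT (fun w => \sum_(j <- J1) Y j w + c).
      by apply: measurable_funD => //; exact: L2_measurable (L2_sum_rv J1).
    have mc := L1_measurable (L1_cos P ms).
    under eq_fun do rewrite mulrC.
    apply: (@L1_mul_bounded _ _ _ P _ _ 1) => //; first exact: bprod (bF' t).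
    by move=> w; exact: cos_max.
  rewrite meanD// !ih//; [|exact: bF'|exact: bF'].
  rewrite (mFE 0) (mFE (- (pi / 2))) cosN cos_pihalf !(mulr0, mul0r)
    addr0 cos0 mulr1.
  rewrite !mulrA; congr (_ * _); rewrite mulrAC -expRD big_cons;
    congr (expR _ * _).
  by field.
apply/funext => w; rewrite !FE big_cons addr0 cosBpihalf !mulrA -mulrDl.
congr (_ * _); rewrite -addrA addrC cosD [in RHS](addrA _ b) cosDpihalf.
by rewrite mulNr mulrC.
Qed.

Lemma gaussian_cosine_sum (J : seq I) : uniq J ->
  gaussian_cosine P (fun w => \sum_(j <- J) Y j w).
Proof.
move=> uJ b; have := @cos_sum_prod J [::] (fun _ _ => 0) b.
rewrite cats0 => /(_ uJ) H; rewrite mean_sqr_sum//.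
have <- : (fun w =>
    cos (\sum_(j <- J) Y j w + b) * \prod_(j <- [::] : seq I) (0 : K)) =
    (fun w => cos (\sum_(j <- J) Y j w + b)).
  by apply/funext => w; rewrite big_nil mulr1.
rewrite H// -[RHS]mulr1; congr (_ * _); rewrite -[RHS](mean_cst P); congr mean.
by apply/funext => w; rewrite big_nil.
Qed.

End Independence.

(** * Covariance matrices *)

Section MeasurableMatrix.
Context (d : measure_display) (T : measurableType d) (K : realType).

Lemma measurable_entry m n (i : 'I_m) (j : 'I_n) :
  measurable_fun setT (fun M : 'M[K]_(m, n) => M i j).
Proof.
move=> _ B mB; rewrite setTI; apply: sub_sigma_algebra.
by exists (i, j) => //; exists B => //; rewrite setTI.
Qed.

Lemma measurable_mx m n (f : T -> 'M[K]_(m, n)) :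
  (forall i j, measurable_fun setT (fun w => f w i j)) -> measurable_fun setT f.
Proof.
move=> mf _ B mB; rewrite setTI.
have sT : sigma_algebra setT (@measurable d T) by
  exact: sigma_algebra_measurable.
apply: (preimage_sigma_algebra sT _ mB) => _ [[i j] _ [A mA <-]] /=.
by rewrite setTI -comp_preimage -[X in measurable X]setTI; exact: mf.
Qed.

Lemma measurable_fun_entry m n (f : T -> 'M[K]_(m, n)) i j :
  measurable_fun setT f -> measurable_fun setT (fun w => f w i j).
Proof. by move=> mf; exact: (measurableT_comp (measurable_entry i j) mf). Qed.

Lemma measurable_mulmx_entry m n p (A : 'M[K]_(p, m))
    (f : T -> 'M[K]_(m, n)) i j :
  (forall i j, measurable_fun setT (fun w => f w i j)) ->
  measurable_fun setT (fun w => (A *m f w) i j).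
Proof.
move=> mf; under eq_fun do rewrite mxE.
by apply: measurable_sum => k; apply: measurable_funM => //;
  exact: measurable_cst.
Qed.

End MeasurableMatrix.

Section Covariance.
Context (d : measure_display) (T : measurableType d) (K : realType)
  (P : probability T K).

Definition L2vec p (X : T -> 'cV[K]_p) := forall i, L2 P (fun w => X w i 0).

Definition cov p q (X : T -> 'cV[K]_p) (Y : T -> 'cV[K]_q) : 'M[K]_(p, q) :=
  \matrix_(i, j) mean P (fun w => X w i 0 * Y w j 0).

Lemma L2vecD p (X Y : T -> 'cV[K]_p) : L2vec X -> L2vec Y ->
  L2vec (fun w => X w + Y w).
Proof. by move=> lX lY i; under eq_fun do rewrite mxE; exact: L2D. Qed.

Lemma L2vecM p q (A : 'M[K]_(q, p)) (X : T -> 'cV[K]_p) : L2vec X ->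
  L2vec (fun w => A *m X w).
Proof.
move=> lX i; under eq_fun do rewrite mxE.
by apply: L2_sum => j; exact: L2Z.
Qed.

Lemma L2vecZ p a (X : T -> 'cV[K]_p) : L2vec X -> L2vec (fun w => a *: X w).
Proof. by move=> lX i; under eq_fun do rewrite mxE; exact: L2Z. Qed.

Lemma L2vec_sum p (I : Type) (s : seq I) (X : I -> T -> 'cV[K]_p) :
  (forall k, L2vec (X k)) -> L2vec (fun w => \sum_(k <- s) X k w).
Proof. by move=> lX i; under eq_fun do rewrite summxE; apply: L2_sum => k;
  exact: lX. Qed.

Lemma cov_tr p q (X : T -> 'cV[K]_p) (Y : T -> 'cV[K]_q) :
  (cov X Y)^T = cov Y X.
Proof.
by apply/matrixP => i j; rewrite !mxE; congr mean; apply/funext => w;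
  rewrite mulrC.
Qed.

Lemma covDl p q (X X' : T -> 'cV[K]_p) (Y : T -> 'cV[K]_q) :
  L2vec X -> L2vec X' -> L2vec Y ->
  cov (fun w => X w + X' w) Y = cov X Y + cov X' Y.
Proof.
move=> lX lX' lY; apply/matrixP => i j; rewrite !mxE.
rewrite -meanD; [|exact: L2M..].
by congr mean; apply/funext => w; rewrite mxE mulrDl.
Qed.

Lemma covDr p q (X : T -> 'cV[K]_p) (Y Y' : T -> 'cV[K]_q) :
  L2vec X -> L2vec Y -> L2vec Y' ->
  cov X (fun w => Y w + Y' w) = cov X Y + cov X Y'.
Proof. by move=> lX lY lY'; rewrite -cov_tr covDl// linearD/= !cov_tr. Qed.

Lemma covMl p q r (A : 'M[K]_(r, p)) (X : T -> 'cV[K]_p) (Y : T -> 'cV[K]_q) :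
  L2vec X -> L2vec Y -> cov (fun w => A *m X w) Y = A *m cov X Y.
Proof.
move=> lX lY; apply/matrixP => i j; rewrite !mxE.
rewrite (_ : (fun w => _) = (fun w => \sum_k A i k * (X w k 0 * Y w j 0))).
  rewrite mean_sum => [|k]; last by apply: L1Z; exact: L2M.
  by apply: eq_bigr => k _; rewrite mxE meanZ//; exact: L2M.
by apply/funext => w; rewrite mxE mulr_suml; apply: eq_bigr => k _;
  rewrite mulrA.
Qed.

Lemma covMr p q r (A : 'M[K]_(r, q)) (X : T -> 'cV[K]_p) (Y : T -> 'cV[K]_q) :
  L2vec X -> L2vec Y -> cov X (fun w => A *m Y w) = cov X Y *m A^T.
Proof. by move=> lX lY; rewrite -cov_tr covMl// trmx_mul cov_tr. Qed.

Lemma covZl p q a (X : T -> 'cV[K]_p) (Y : T -> 'cV[K]_q) :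
  L2vec X -> L2vec Y -> cov (fun w => a *: X w) Y = a *: cov X Y.
Proof.
move=> lX lY; rewrite -mul_scalar_mx -covMl//.
by congr cov; apply/funext => w; rewrite mul_scalar_mx.
Qed.

Lemma cov_suml p q (I : Type) (s : seq I) (X : I -> T -> 'cV[K]_p)
    (Y : T -> 'cV[K]_q) : (forall k, L2vec (X k)) -> L2vec Y ->
  cov (fun w => \sum_(k <- s) X k w) Y = \sum_(k <- s) cov (X k) Y.
Proof.
move=> lX lY; apply/matrixP => i j; rewrite summxE mxE.
under [RHS]eq_bigr do rewrite mxE.
rewrite -mean_sum => [|k]; last by apply: L2M; [exact: lX|exact: lY].
by congr mean; apply/funext => w; rewrite summxE mulr_suml.
Qed.

Lemma mxbilE p (M : 'M[K]_p) (u v : 'cV[K]_p) :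
  mxbil M u v = \sum_i \sum_j M i j * (u i 0 * v j 0).
Proof.
rewrite /mxbil mxE exchange_big/=; apply: eq_bigr => j _.
rewrite mxE mulr_suml; apply: eq_bigr => i _; rewrite mxE; ring.
Qed.

Lemma L1_mxbil p (M : 'M[K]_p) (X Y : T -> 'cV[K]_p) : L2vec X -> L2vec Y ->
  L1 P (fun w => mxbil M (X w) (Y w)).
Proof.
move=> lX lY; under eq_fun do rewrite mxbilE.
by apply: L1_sum => i; apply: L1_sum => j; apply: L1Z; exact: L2M.
Qed.

Lemma mean_mxbil p (M : 'M[K]_p) (X Y : T -> 'cV[K]_p) : L2vec X -> L2vec Y ->
  mean P (fun w => mxbil M (X w) (Y w)) = \sum_i \sum_j M i j * cov X Y i j.
Proof.
move=> lX lY; under eq_fun do rewrite mxbilE.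
have l1 i j : L1 P (fun w => M i j * (X w i 0 * Y w j 0)).
  by apply: L1Z; exact: L2M.
rewrite mean_sum => [|i]; last by apply: L1_sum.
apply: eq_bigr => i _; rewrite mean_sum//; apply: eq_bigr => j _.
by rewrite meanZ ?mxE//; exact: L2M.
Qed.

(** The second moments are diagonal entries of S, hence finite. *)
Lemma has_covariance_L2vec p (X : T -> 'cV[K]_p) S : measurable_fun setT X ->
  has_covariance P X S -> L2vec X.
Proof.
move=> mX cX i; have mXi := measurable_fun_entry i 0 mX; split=> //.
apply/integrableP; split; first by apply/measurable_EFinP;
  exact: measurable_funX.
have := cX i i; rewrite unlock => H.
rewrite (_ : (\int[P]_x _)%E = (S i i)%:E) ?ltry// -H.
apply: eq_integral => w _ /=; rewrite ger0_norm ?sqr_ge0//.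
by rewrite mxE big_ord1 mxE expr2.
Qed.

Lemma has_covarianceE p (X : T -> 'cV[K]_p) S : has_covariance P X S ->
  cov X X = S.
Proof.
move=> cX; apply/matrixP => i j; rewrite mxE /mean /Rintegral.
have := cX i j; rewrite unlock => H.
rewrite (_ : (\int[P]_x _)%E = (S i j)%:E)// -H.
by apply: eq_integral => w _ /=; rewrite mxE big_ord1 !mxE.
Qed.

Lemma zero_meanE p (X : T -> 'cV[K]_p) : zero_mean P X ->
  forall i, mean P (fun w => X w i 0) = 0.
Proof. by move=> zX i; have := zX i; rewrite unlock /mean /Rintegral => ->. Qed.

End Covariance.

(** * Linear functions of the state and the noises *)

Definition dot (K : realType) p (a v : 'cV[K]_p) : K := (a^T *m v) 0 0.

Lemma dotE (K : realType) p (a v : 'cV[K]_p) : dot a v = \sum_i a i 0 * v i 0.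
Proof. by rewrite /dot mxE; apply: eq_bigr => i _; rewrite mxE. Qed.

Lemma dot_delta (K : realType) p (i : 'I_p) (v : 'cV[K]_p) :
  dot (delta_mx i 0) v = v i 0.
Proof. by rewrite /dot trmx_delta -rowE mxE. Qed.

Lemma dotDl (K : realType) p (a b v : 'cV[K]_p) :
  dot (a + b) v = dot a v + dot b v.
Proof. by rewrite /dot linearD/= mulmxDl mxE. Qed.

Lemma dotZl (K : realType) p (c : K) (a v : 'cV[K]_p) :
  dot (c *: a) v = c * dot a v.
Proof. by rewrite /dot linearZ/= -scalemxAl mxE. Qed.

Section GaussianFamily.
Context (d : measure_display) (T : measurableType d) (K : realType)
  (P : probability T K) (n m : nat).
Variables (x : T -> 'cV[K]_n) (z : nat -> T -> 'cV[K]_m).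
Hypothesis mx : measurable_fun setT x.
Hypothesis mz : forall k, measurable_fun setT (z k).
Hypothesis lx : L2vec P x.
Hypothesis lz : forall k, L2vec P (z k).
Hypothesis x0 : zero_mean P x.
Hypothesis z0 : forall k, zero_mean P (z k).
Hypothesis gx : gaussian_vector P x.
Hypothesis gz : forall k, gaussian_vector P (z k).
Hypothesis xz_indep : independent_noise P x z.

Let L2_dot p (a : 'cV[K]_p) (X : T -> 'cV[K]_p) : L2vec P X ->
  L2 P (fun w => dot a (X w)).
Proof.
by move=> lX; under eq_fun do rewrite dotE; apply: L2_sum => i; apply: L2Z.
Qed.

Let mean_dot p (a : 'cV[K]_p) (X : T -> 'cV[K]_p) : L2vec P X ->
  zero_mean P X ->
  mean P (fun w => dot a (X w)) = 0.
Proof.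
move=> lX X0; under eq_fun do rewrite dotE.
rewrite mean_sum => [|i]; last by apply: L1Z; exact: L2_L1.
by rewrite big1// => i _; rewrite meanZ ?zero_meanE ?mulr0//; exact: L2_L1.
Qed.

Let gaussian_dot p (a : 'cV[K]_p) (X : T -> 'cV[K]_p) : L2vec P X ->
  zero_mean P X -> gaussian_vector P X ->
    gaussian_cosine P (fun w => dot a (X w)).
Proof.
move=> lX X0 gX; apply: gaussian_cos; [exact: L2_dot|exact: mean_dot|].
by have [mu [s H]] := gX a; exists mu, s.
Qed.

(** The indexing of independent_noise: [None] stands for x. *)
Let E : option nat -> set (set T) := fun k => if k is Some i
  then preimage_set_system setT (z i) measurable
  else preimage_set_system setT x measurable.

Let mE k A : E k A -> measurable A.
Proof. by case: k => [i|] [B mB <-]; [exact: mz|exact: mx]. Qed.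

Let Y (a : 'cV[K]_n) (b : nat -> 'cV[K]_m) (k : option nat) (w : T) : K :=
  if k is Some i then dot (b i) (z i w) else dot a (x w).

Let measurable_dot p (a : 'cV[K]_p) : measurable_fun setT (dot a).
Proof.
apply: (@measurable_fun_entry _ _ _ _ _ (fun v => a^T *m v)).
apply: measurable_mx => i j; apply: measurable_mulmx_entry => i' j'.
exact: measurable_entry.
Qed.

Let aY a b k : adapted (E k) (Y a b k).
Proof.
move=> B mB; case: k => [i|] /=.
  exists (dot (b i) @^-1` B); last by rewrite setTI.
  by rewrite -[X in measurable X]setTI; exact: measurable_dot.
exists (dot a @^-1` B); last by rewrite setTI.
by rewrite -[X in measurable X]setTI; exact: measurable_dot.
Qed.

Let lY a b k : L2 P (Y a b k).
Proof. by case: k => [i|]; exact: L2_dot. Qed.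

Let Y0 a b k : mean P (Y a b k) = 0.
Proof. by case: k => [i|]; exact: mean_dot. Qed.

Let gY a b k : gaussian_cosine P (Y a b k).
Proof. by case: k => [i|]; exact: gaussian_dot. Qed.

Lemma cov_state_noise k : cov P x (z k) = 0.
Proof.
apply/matrixP => i j; rewrite !mxE.
have := @independent_uncorrelated _ _ _ P _ E mE xz_indep
  (Y (delta_mx i 0) (fun=> delta_mx j 0)) (aY _ _) (lY _ _) (Y0 _ _)
  None (Some k) isT.
by under eq_fun do rewrite /= !dot_delta.
Qed.

Lemma cov_noise_noise k l : k != l -> cov P (z k) (z l) = 0.
Proof.
move=> kl; apply/matrixP => i j; rewrite !mxE.
have skl : Some k != Some l by apply: contraNneq kl => -[->].
have := @independent_uncorrelated _ _ _ P _ E mE xz_indep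
  (Y 0 (fun q => if q == k then delta_mx i 0 else delta_mx j 0)) (aY _ _)
    (lY _ _) (Y0 _ _)
  (Some k) (Some l) skl.
by rewrite /= eqxx eq_sym (negbTE kl); under eq_fun do rewrite !dot_delta.
Qed.

Definition linear_form (N : nat) (a : 'cV[K]_n) (b : nat -> 'cV[K]_m) (w : T) :
  K :=
  dot a (x w) + \sum_(k < N) dot (b k) (z k w).

Let linear_formE N a b w : linear_form N a b w =
  \sum_(k <- None :: map Some (iota 0 N)) Y a b k w.
Proof.
rewrite big_cons big_map /linear_form; congr (_ + _).
by rewrite -(big_mkord xpredT (fun k => dot (b k) (z k w))) /index_iota subn0.
Qed.

Let uniq_index N : uniq (None :: map Some (iota 0 N)).
Proof.
rewrite cons_uniq map_inj_uniq ?iota_uniq ?andbT => [|? ? [->]//].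
by apply/mapP => -[].
Qed.

Lemma L2_linear_form N a b : L2 P (linear_form N a b).
Proof.
apply: L2D; first exact: L2_dot.
by apply: L2_sum => k; exact: L2_dot.
Qed.

Lemma gaussian_linear_form N a b : gaussian_cosine P (linear_form N a b).
Proof.
rewrite (_ : linear_form N a b =
  fun w => \sum_(k <- None :: map Some (iota 0 N)) Y a b k w); last first.
  by apply/funext => w; exact: linear_formE.
exact: (gaussian_cosine_sum mE xz_indep (aY a b) (lY a b) (Y0 a b) (gY a b)
  (uniq_index N)).
Qed.

Lemma linear_form_cos N a b a' b' :
  mean P (fun w => linear_form N a b w * linear_form N a' b' w) = 0 ->
  forall c, mean P
    (fun w => linear_form N a' b' w * cos (linear_form N a b w + c)) = 0.
Proof.
apply: uncorrelated_cos; [exact: L2_linear_form..|].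
move=> h; have := gaussian_linear_form N (a + h *: a')
  (fun k => b k + h *: b' k).
congr gaussian_cosine; apply/funext => w.
rewrite /linear_form dotDl dotZl mulrDr mulr_sumr addrACA -big_split/=.
by congr (_ + _); apply: eq_bigr => k _; rewrite dotDl dotZl.
Qed.

(** The jointly Gaussian vectors: linear functions of x and the first N
    noises. *)
Definition linear_vector (N p : nat) (X : T -> 'cV[K]_p) :=
  exists (A : 'M[K]_(p, n)) (B : nat -> 'M[K]_(p, m)),
    forall w, X w = A *m x w + \sum_(k < N) B k *m z k w.

Lemma linear_vector_form N p (X : T -> 'cV[K]_p) : linear_vector N X ->
  forall c : 'cV[K]_p, exists a b, forall w, dot c (X w) = linear_form N a b w.
Proof.
move=> [A [B XE]] c; exists (A^T *m c), (fun k => (B k)^T *m c) => w.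
rewrite XE /linear_form /dot mulmxDr mxE mulmx_sumr summxE.
congr (_ + _); first by rewrite trmx_mul trmxK mulmxA.
by apply: eq_bigr => k _; rewrite trmx_mul trmxK mulmxA.
Qed.

Lemma linear_vector_state N : linear_vector N x.
Proof.
exists 1%:M, (fun=> 0) => w; rewrite mul1mx big1 ?addr0// => k _.
by rewrite mul0mx.
Qed.

Lemma linear_vector_noise N i : (i < N)%N -> linear_vector N (z i).
Proof.
move=> iN; exists 0, (fun k => if k == i then 1%:M else 0) => w.
rewrite mul0mx add0r (bigD1 (Ordinal iN))//= eqxx mul1mx big1 ?addr0// => k ki.
by rewrite ifN ?mul0mx//; apply: contra ki => /eqP ki; apply/eqP/val_inj.
Qed.

Lemma linear_vectorD N p (X X' : T -> 'cV[K]_p) : linear_vector N X ->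
  linear_vector N X' -> linear_vector N (fun w => X w + X' w).
Proof.
move=> [A [B XE]] [A' [B' XE']]; exists (A + A'), (fun k => B k + B' k) => w.
rewrite XE XE' mulmxDl addrACA -big_split/=; congr (_ + _).
by apply: eq_bigr => k _; rewrite mulmxDl.
Qed.

Lemma linear_vectorM N p q (M : 'M[K]_(q, p)) (X : T -> 'cV[K]_p) :
  linear_vector N X -> linear_vector N (fun w => M *m X w).
Proof.
move=> [A [B XE]]; exists (M *m A), (fun k => M *m B k) => w.
rewrite XE mulmxDr mulmxA mulmx_sumr; congr (_ + _).
by apply: eq_bigr => k _; rewrite mulmxA.
Qed.

Lemma linear_vectorZ N p (c : K) (X : T -> 'cV[K]_p) :
  linear_vector N X -> linear_vector N (fun w => c *: X w).
Proof.
by move=> /(linear_vectorM c%:M); under eq_fun do rewrite mul_scalar_mx.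
Qed.

Lemma linear_vector_sum N p (X : nat -> T -> 'cV[K]_p) M :
  (forall k, (k < M)%N -> linear_vector N (X k)) ->
  linear_vector N (fun w => \sum_(k < M) X k w).
Proof.
elim: M => [|M ih] lX.
  exists 0, (fun=> 0) => w; rewrite big_ord0 mul0mx add0r big1// => k _.
  by rewrite mul0mx.
under eq_fun do rewrite big_ord_recr/=; apply: linear_vectorD; last exact: lX.
by apply: ih => k kM; apply: lX; exact: ltnW.
Qed.

Lemma L2vec_linear N p (X : T -> 'cV[K]_p) : linear_vector N X -> L2vec P X.
Proof.
move=> lX i; have [a [b abE]] := linear_vector_form lX (delta_mx i 0).
have := L2_linear_form N a b; congr L2; apply/funext => w.
by rewrite -abE dot_delta.
Qed.

(** For jointly Gaussian vectors X and V, the conditional mean of X given V is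
    zero if X and V are uncorrelated. *)
Lemma uncorrelated_orthogonal N p q (V : T -> 'cV[K]_p) (X : T -> 'cV[K]_q) :
  linear_vector N V -> linear_vector N X -> cov P X V = 0 ->
  forall (g : 'cV[K]_p -> K) (i : 'I_q), measurable_fun setT g ->
    L2 P (fun w => g (V w)) -> mean P (fun w => X w i 0 * g (V w)) = 0.
Proof.
move=> lV lX XV0 g i mg lg.
have l2V := L2vec_linear lV; have l2X := L2vec_linear lX.
have mVe j : measurable_fun setT (fun w => V w j 0) by exact: L2_measurable.
have mV : measurable_fun setT V by apply: measurable_mx => j k;
  rewrite (ord1 k).
apply: (mean_mul_eq0 _ mV mg); [exact: L2_L1|exact: L2M|].
apply: mean_indic_eq0 => // [|c b]; first exact: L2_L1.
have [a1 [b1 E1]] := linear_vector_form lV c.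
have [a2 [b2 E2]] := linear_vector_form lX (delta_mx i 0).
rewrite (_ : (fun w => _) = (fun w =>
    linear_form N a2 b2 w * cos (linear_form N a1 b1 w + b))); last first.
  by apply/funext => w; rewrite -E1 -E2 dot_delta.
apply: linear_form_cos.
rewrite (_ : (fun w => _) = (fun w => \sum_j c j 0 * (X w i 0 * V w j 0))).
  rewrite mean_sum => [|j]; last by apply: L1Z; exact: L2M.
  rewrite big1// => j _; rewrite meanZ; last exact: L2M.
  by have := congr1 (fun M : 'M[K]_(q, p) => M i j) XV0; rewrite !mxE => ->;
    rewrite mulr0.
apply/funext => w; rewrite -E1 -E2 dot_delta dotE mulr_suml.
by apply: eq_bigr => j _; ring.
Qed.

End GaussianFamily.

(** * Quadratic forms and the team loss *)

Section BilinearForms.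
Context (K : realType) (p : nat).
Implicit Types (M : 'M[K]_p) (u v w : 'cV[K]_p).

Lemma mxbilDl M u v w : mxbil M (u + v) w = mxbil M u w + mxbil M v w.
Proof. by rewrite /mxbil linearD/= !mulmxDl mxE. Qed.

Lemma mxbilDr M u v w : mxbil M u (v + w) = mxbil M u v + mxbil M u w.
Proof. by rewrite /mxbil mulmxDr mxE. Qed.

Lemma mxbilZl M a u v : mxbil M (a *: u) v = a * mxbil M u v.
Proof. by rewrite /mxbil linearZ/= -!scalemxAl mxE. Qed.

Lemma mxbilZr M a u v : mxbil M u (a *: v) = a * mxbil M u v.
Proof. by rewrite /mxbil -scalemxAr mxE. Qed.

Lemma mxbil_suml (I : Type) (s : seq I) M (u : I -> 'cV[K]_p) v :
  mxbil M (\sum_(i <- s) u i) v = \sum_(i <- s) mxbil M (u i) v.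
Proof.
elim: s => [|i s ih]; last by rewrite !big_cons mxbilDl ih.
by rewrite !big_nil /mxbil trmx0 !mul0mx mxE.
Qed.

Lemma mxbilC M u v : M^T = M -> mxbil M u v = mxbil M v u.
Proof.
move=> MT; rewrite /mxbil -[LHS]/(_ 0 0) -[u^T *m M *m v]trmxK mxE.
by rewrite !trmx_mul trmxK MT mulmxA.
Qed.

Lemma mxbil_addm (M N : 'M[K]_p) u v :
  mxbil (M + N) u v = mxbil M u v + mxbil N u v.
Proof. by rewrite /mxbil mulmxDr mulmxDl mxE. Qed.

Lemma mxbil_scalem a M u v : mxbil (a *: M) u v = a * mxbil M u v.
Proof. by rewrite /mxbil -scalemxAr -scalemxAl mxE. Qed.

Lemma mxbil_dot M u v : mxbil M u v = dot u (M *m v).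
Proof. by rewrite /mxbil /dot mulmxA. Qed.

Lemma dotDr u v w : dot u (v + w) = dot u v + dot u w.
Proof. by rewrite /dot mulmxDr mxE. Qed.

Lemma dotZr a u v : dot u (a *: v) = a * dot u v.
Proof. by rewrite /dot -scalemxAr mxE. Qed.

Lemma dotNr u v : dot u (- v) = - dot u v.
Proof. by rewrite /dot mulmxN mxE. Qed.

Lemma posdef_possemidef M : posdefmx M -> possemidefmx M.
Proof.
move=> [MT M0]; split=> // u; have [->|u0] := eqVneq u 0; last exact/ltW/M0.
by rewrite /mxbil mulmx0 mxE.
Qed.

Lemma mxbil_cauchy_schwarz M u v : possemidefmx M ->
  mxbil M u v ^+ 2 <= mxbil M u u * mxbil M v v.
Proof.
move=> [MT M0]; set a := mxbil M u u; set b := mxbil M u v;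
  set c := mxbil M v v.
have H (s t : K) : 0 <= s ^+ 2 * a + 2 * (s * t * b) + t ^+ 2 * c.
  have := M0 (s *: u + t *: v).
  rewrite mxbilDl !mxbilDr !mxbilZl !mxbilZr (mxbilC v u MT) -/a -/b -/c.
  by congr (0 <= _); ring.
have a0 : 0 <= a by exact: M0.
have c0 : 0 <= c by exact: M0.
(* If c = 0 then a + 2 t b >= 0 for all t, which forces b = 0; otherwise the
   vector c u - b v gives the claim. *)
have [cz|cn] := eqVneq c 0.
  have [->|bn] := eqVneq b 0; first by rewrite expr0n mulr_ge0.
  have := H 1 (- (a + 1) / (2 * b)); rewrite cz mulr0 addr0.
  rewrite (_ : 2 * (1 * _ * b) = - (a + 1)); last by field.
  by rewrite expr1n mul1r; lra.
have cp : 0 < c by rewrite lt_neqAle eq_sym cn.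
have := H c (- b).
rewrite (_ : _ + _ = c * (a * c - b ^+ 2)); last by ring.
by rewrite pmulr_rge0// subr_ge0.
Qed.

Lemma posdef_unit M : posdefmx M -> M \in unitmx.
Proof.
move=> [MT M0]; rewrite -row_free_unit; apply: inj_row_free => v vM.
apply/eqP; apply: contraT => v0.
have := M0 v^T; rewrite trmx_eq0 => /(_ v0).
by rewrite /mxbil trmxK vM mul0mx mxE ltxx.
Qed.

(** A positive definite form dominates each squared coordinate, since
    u i = M (u, M^-1 e_i) and the Cauchy-Schwarz inequality applies. *)
Lemma posdef_coordinate M : posdefmx M ->
  exists2 c, 0 <= c & forall (i : 'I_p) u, u i 0 ^+ 2 <= c * mxbil M u u.
Proof.
move=> Mp; have Ms := posdef_possemidef Mp; have MU := posdef_unit Mp.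
pose e i : 'cV[K]_p := invmx M *m delta_mx i 0.
exists (\sum_i mxbil M (e i) (e i)).
  by apply: sumr_ge0 => i _; case: Ms => _; apply.
move=> i u; have -> : u i 0 = mxbil M u (e i).
  by rewrite mxbil_dot /e mulKVmx// /dot -colE !mxE.
apply: le_trans (mxbil_cauchy_schwarz _ _ Ms) _; rewrite mulrC.
have [_ M0] := Ms; rewrite ler_wpM2r// (bigD1 i)//= lerDl.
by apply: sumr_ge0.
Qed.

(** The square completed is that of u + 2 M^-1 v. *)
Lemma posdef_young M u v : posdefmx M ->
  0 <= 2^-1 * mxbil M u u + 2 * dot u v + 2 * mxbil (invmx M) v v.
Proof.
move=> Mp; have [MT M0] := posdef_possemidef Mp; have MU := posdef_unit Mp.
have := M0 (u + 2 *: (invmx M *m v)).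
rewrite mxbilDl !mxbilDr !mxbilZl !mxbilZr (mxbilC (invmx M *m v) u MT).
have -> : mxbil M u (invmx M *m v) = dot u v by rewrite mxbil_dot mulKVmx.
have -> : mxbil M (invmx M *m v) (invmx M *m v) = mxbil (invmx M) v v.
  rewrite mxbil_dot mulKVmx// /dot /mxbil trmx_mul trmx_inv MT//.
lra.
Qed.

End BilinearForms.

Section TeamLoss.
Context (K : realType) (n N : nat) (R D Q : 'M[K]_n).
Hypothesis R_sym : R^T = R.
Hypothesis D_ge0 : possemidefmx D.
Hypothesis Q_ge0 : possemidefmx Q.
Implicit Types (x : 'cV[K]_n) (u e : 'I_N -> 'cV[K]_n).
Let t : K := N%:R^-1.

(** Half the gradient of the loss with respect to the decision u i. *)
Definition marginal x u (i : 'I_N) : 'cV[K]_n :=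
  R *m u i - D *m (x + (2 * t) *: \sum_k u k) +
    t *: (Q *m (x + t *: \sum_k u k)).

(** The part of the loss that is quadratic in the decisions. *)
Definition team_curvature e : K :=
  \sum_i mxbil R (e i) (e i) - 2 * t * mxbil D (\sum_i e i) (\sum_i e i)
  + t ^+ 2 * mxbil Q (\sum_i e i) (\sum_i e i).

Lemma team_loss_expansion x u e :
  team_loss R D Q x (fun i => u i + e i) =
  team_loss R D Q x u + 2 * \sum_i dot (e i) (marginal x u i) +
    team_curvature e.
Proof.
rewrite /team_loss /team_curvature -/t big_split/=.
rewrite -!mxbil_suml big_split/=; set U := \sum_i u i; set W := \sum_i e i.
have -> : \sum_i mxbil R (u i + e i) (u i + e i) = \sum_i mxbil R (u i) (u i) +
    2 * \sum_i mxbil R (e i) (u i) + \sum_i mxbil R (e i) (e i).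
  rewrite mulr_sumr -!big_split/=; apply: eq_bigr => i _.
  by rewrite mxbilDl !mxbilDr (mxbilC (u i) (e i) R_sym); ring.
have -> : \sum_i dot (e i) (marginal x u i) = \sum_i mxbil R (e i) (u i) -
    mxbil D W (x + (2 * t) *: U) + t * mxbil Q W (x + t *: U).
  rewrite /W !mxbil_suml mulr_sumr -sumrB -big_split/=; apply: eq_bigr => i _.
  rewrite /marginal -/U dotDr dotDr dotNr dotZr -!mxbil_dot; ring.
have [DT _] := D_ge0; have [QT _] := Q_ge0.
rewrite scalerDr addrA !(mxbilDl, mxbilDr, mxbilZl, mxbilZr).
rewrite (mxbilC U W DT) (mxbilC x W QT) (mxbilC U W QT) (mxbilC x U QT); ring.
Qed.

Hypothesis N_gt0 : (0 < N)%N.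

Let tN : t * N%:R = 1.
Proof. by rewrite mulVf// pnatr_eq0 -lt0n. Qed.

(** Expand the sum of M (e i - W / N, e i - W / N), where W is the sum of the
    e i. *)
Lemma jensen_mxbil (M : 'M[K]_n) e : possemidefmx M ->
  t * mxbil M (\sum_i e i) (\sum_i e i) <= \sum_i mxbil M (e i) (e i).
Proof.
move=> [MT M0]; set W := \sum_i e i.
have : 0 <= \sum_(i < N) mxbil M (e i + (- t) *: W) (e i + (- t) *: W).
  by apply: sumr_ge0 => i _.
have -> : \sum_(i < N) mxbil M (e i + (- t) *: W) (e i + (- t) *: W) =
  \sum_i mxbil M (e i) (e i) + (- (2 * t)) * mxbil M W W +
    N%:R * (t ^+ 2 * mxbil M W W).
  rewrite (eq_bigr
    (fun i => mxbil M (e i) (e i) + (- (2 * t)) * mxbil M (e i) W +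
      t ^+ 2 * mxbil M W W)) => [|i _].
    rewrite !big_split/= sumr_const card_ord -mulr_sumr -mxbil_suml.
    by rewrite -/W [N%:R * _]mulr_natl.
  by rewrite mxbilDl !mxbilDr !mxbilZl !mxbilZr (mxbilC W (e i) MT); ring.
have -> : N%:R * (t ^+ 2 * mxbil M W W) =
  (t * N%:R) * (t * mxbil M W W) by ring.
rewrite tN mul1r.
lra.
Qed.

(** By Jensen the term in D is at most 2 sum_i D (e i, e i). The loss is thus
    strongly convex, with a constant independent of N. *)
Lemma team_curvature_ge e : \sum_i mxbil (R - 2 *: D) (e i) (e i) <=
  team_curvature e.
Proof.
have -> : \sum_i mxbil (R - 2 *: D) (e i) (e i) =
    \sum_i mxbil R (e i) (e i) + (- 2) * \sum_i mxbil D (e i) (e i).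
  rewrite mulr_sumr -big_split/=; apply: eq_bigr => i _.
  by rewrite -scaleNr mxbil_addm mxbil_scalem.
have := jensen_mxbil e D_ge0; have [_ Q0] := Q_ge0.
have := mulr_ge0 (sqr_ge0 t) (Q0 (\sum_i e i)).
rewrite /team_curvature; lra.
Qed.

Lemma team_curvature_le e :
  team_curvature e <= \sum_i mxbil (R + Q) (e i) (e i).
Proof.
have -> : \sum_i mxbil (R + Q) (e i) (e i) =
    \sum_i mxbil R (e i) (e i) + \sum_i mxbil Q (e i) (e i).
  by rewrite -big_split/=; apply: eq_bigr => i _; rewrite mxbil_addm.
have t0 : 0 <= t by rewrite invr_ge0.
have t1 : t <= 1 by rewrite invf_le1 ?ltr0n// ler1n.
have [_ D0] := D_ge0; have [_ Q0] := Q_ge0.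
have := jensen_mxbil e Q_ge0; have := mulr_ge0 t0 (D0 (\sum_i e i)).
have : t ^+ 2 * mxbil Q (\sum_i e i) (\sum_i e i) <=
  t * mxbil Q (\sum_i e i) (\sum_i e i).
  by apply: ler_wpM2r => //; rewrite expr2 ler_piMl.
rewrite /team_curvature; lra.
Qed.

End TeamLoss.

(** * The equation of the optimal gain *)

Lemma injective_linear_onto (K : fieldType) n m
    (f : 'M[K]_(n, m) -> 'M[K]_(n, m)) :
  linear f -> (forall u, f u = 0 -> u = 0) -> forall b, exists u, f u = b.
Proof.
move=> lf f0 b.
pose F : {linear 'M[K]_(n, m) -> 'M[K]_(n, m)} :=
  HB.pack f (GRing.isLinear.Build _ _ _ _ f lf).
have FU : lin_mx F \in unitmx.
  rewrite -row_free_unit; apply: inj_row_free => v.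
  rewrite -[v]vec_mxK mul_vec_lin /=; move: (vec_mx v) => u /(congr1 vec_mx).
  by rewrite mxvecK linear0 => /f0 ->; rewrite linear0.
exists (vec_mx (mxvec b *m invmx (lin_mx F))).
apply: (can_inj mxvecK); rewrite -[LHS]/(mxvec (F _)) -mul_vec_lin vec_mxK.
by rewrite mulmxKV.
Qed.

Section TraceForm.
Context (K : realType) (n m : nat).

(** If W is the covariance of X, this is E M (e X, e X); see trform_cov. *)
Definition trform (M : 'M[K]_n) (e : 'M[K]_(n, m)) (W : 'M[K]_m) : K :=
  \tr (e^T *m M *m e *m W).

Lemma trformDl M N e W : trform (M + N) e W = trform M e W + trform N e W.
Proof. by rewrite /trform mulmxDr !mulmxDl linearD. Qed.

Lemma trformDr M e V W : trform M e (V + W) = trform M e V + trform M e W.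
Proof. by rewrite /trform mulmxDr linearD. Qed.

Lemma trformZl a M e W : trform (a *: M) e W = a * trform M e W.
Proof. by rewrite /trform -scalemxAr -!scalemxAl linearZ. Qed.

Lemma trformZr a M e W : trform M e (a *: W) = a * trform M e W.
Proof. by rewrite /trform -scalemxAr linearZ. Qed.

End TraceForm.

(** Each |e k l| is at most c A / 2 + s / (2 c), where s is the sum of all
    |e k l| and c the number of entries: this is the arithmetic-geometric mean
    inequality for e k l ^+ 2 <= A s. Summing and absorbing s / 2 bounds s. *)
Lemma sqr_entries_bound (K : realType) (n m : nat) (e : 'M[K]_(n, m)) (A : K) :
  (forall i j, e i j ^+ 2 <= A * \sum_k \sum_l `|e k l|) ->
  0 <= A -> \sum_k \sum_l `|e k l| <= (n%:R * m%:R) ^+ 2 * A.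
Proof.
set s := \sum_k _ => eA A0.
have s0 : 0 <= s by apply: sumr_ge0 => i _; apply: sumr_ge0.
have [->|sn] := eqVneq s 0; first by rewrite mulr_ge0// sqr_ge0.
have sp : 0 < s by rewrite lt_neqAle eq_sym sn.
pose c : K := n%:R * m%:R.
have c0 : 0 <= c by rewrite mulr_ge0.
have cn : c != 0.
  rewrite mulf_neq0// pnatr_eq0; apply: contraNneq sn => nm; apply/eqP.
    by rewrite /s big1// => i _; exfalso;
      have := leq_ltn_trans (leq0n i) (ltn_ord i); rewrite nm.
  by rewrite /s big1// => i _; rewrite big1// => j _; exfalso;
    have := leq_ltn_trans (leq0n j) (ltn_ord j); rewrite nm.
have cp : 0 < c by rewrite lt_neqAle eq_sym cn.
have b i j : `|e i j| <= (2^-1 * c * A) + s / (2 * c).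
  have := eA i j; rewrite -(real_normK (num_real (e i j))).
  set y := `|e i j| => yA.
  have y0 : 0 <= (y - s / c) ^+ 2 by exact: sqr_ge0.
  have H : 2 * y * (s / c) <= A * s + (s / c) ^+ 2 by nra.
  rewrite -(ler_pM2r (_ : 0 < 2 * (s / c)));
    last by rewrite mulr_gt0// divr_gt0.
  rewrite (_ : y * _ = 2 * y * (s / c)); last by ring.
  apply: le_trans H _; rewrite le_eqVlt; apply/orP; left; apply/eqP; field.
  by rewrite cn.
have : s <= \sum_(k < n) \sum_(l < m) ((2^-1 * c * A) + s / (2 * c)).
  by apply: ler_sum => k _; apply: ler_sum => l _; exact: b.
rewrite !sumr_const !card_ord -[leRHS]mulr_natl -[X in _ <= _ * X]mulr_natl
  mulrA -/c.
rewrite (_ : c * _ = 2^-1 * (c ^+ 2 * A) + 2^-1 * s); last by field.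
by rewrite -/c; lra.
Qed.

Section Gain.
Context (d : measure_display) (T : measurableType d) (K : realType)
  (P : probability T K) (n m : nat).
Variables (R D Q : 'M[K]_n) (C : 'M[K]_(n, m)) (g z : T -> 'cV[K]_m).
Hypothesis D_ge0 : possemidefmx D.
Hypothesis Q_ge0 : possemidefmx Q.
Hypothesis R_gt2D : posdefmx (R - 2 *: D).
Hypothesis lg : L2vec P g.
Hypothesis lz : L2vec P z.
Hypothesis z_pos : posdefmx (cov P z z).
Let G := cov P g g.
Let N0 := cov P z z.

(** The gain p is optimal for N decision makers if
    gain_op (1/N) p = (D - Q / N) C, with C the covariance of x and v; the case
    t = 0 is the limit problem. Here G and N0 are the covariances of H x and of
    the noise, so that v i has covariance G + N0 and the average of the v k has
    covariance G + N0 / N with each v i. *)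
Definition gain_op (t : K) (e : 'M[K]_(n, m)) : 'M[K]_(n, m) :=
  R *m e *m (G + N0) - (2 *: D - t *: Q) *m e *m (G + t *: N0).

Lemma trform_cov (M : 'M[K]_n) (e : 'M[K]_(n, m)) (X : T -> 'cV[K]_m) :
  L2vec P X ->
  trform M e (cov P X X) = mean P (fun w => mxbil M (e *m X w) (e *m X w)).
Proof.
move=> lX; have leX := L2vecM e lX; rewrite mean_mxbil//.
set Z := cov P (fun w => e *m X w) _.
have ZE : e *m cov P X X *m e^T = Z by rewrite /Z covMl// covMr// mulmxA.
rewrite /trform -!mulmxA mxtrace_mulC -!mulmxA (mulmxA e) ZE /mxtrace.
apply: eq_bigr => i _; rewrite mxE; apply: eq_bigr => j _.
by congr (_ * _); rewrite /Z -[in LHS]cov_tr mxE.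
Qed.

Lemma trform_cov_ge0 (M : 'M[K]_n) (e : 'M[K]_(n, m)) (X : T -> 'cV[K]_m) :
  possemidefmx M -> L2vec P X ->
  0 <= trform M e (cov P X X).
Proof. by move=> [MT M0] lX; rewrite trform_cov//; apply: mean_ge0. Qed.

(** The difference of the two sides is
      trform (R - 2D) e G + 2 (1 - t) trform D e N0 + t trform Q e (G + t N0),
    a sum of nonnegative terms. *)
Lemma gain_op_coercive t e : 0 <= t <= 1 ->
  trform (R - 2 *: D) e N0 <= \tr (e^T *m gain_op t e).
Proof.
move=> /andP[t0 t1].
have -> : \tr (e^T *m gain_op t e) = trform R e (G + N0) -
    trform (2 *: D - t *: Q) e (G + t *: N0).
  by rewrite /gain_op mulmxBr linearB/= /trform !mulmxA.
rewrite -!scaleNr !(trformDl, trformDr, trformZl, trformZr).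
have S0 := trform_cov_ge0 e (posdef_possemidef R_gt2D) lg.
move: S0; rewrite -!scaleNr !(trformDl, trformZl) -/G => S0.
have D0 := trform_cov_ge0 e D_ge0 lz.
have Q1 := trform_cov_ge0 e Q_ge0 lg.
have Q2 := trform_cov_ge0 e Q_ge0 lz.
rewrite -/G -/N0 in D0 Q1 Q2.
have t1' : 0 <= 1 - t by rewrite subr_ge0.
have H1 := mulr_ge0 t1' D0; have H2 := mulr_ge0 t0 Q1.
have H3 := mulr_ge0 (mulr_ge0 t0 t0) Q2.
lra.
Qed.

(** The form on the right is E (R - 2D) (e z, e z), which dominates the second
    moment of (e z) i; the latter is the value of N0 at the i-th row of e. *)
Lemma gain_coordinate : exists2 c, 0 <= c &
  forall (e : 'M[K]_(n, m)) i j, e i j ^+ 2 <= c * trform (R - 2 *: D) e N0.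
Proof.
have [a a0 aR] := posdef_coordinate R_gt2D.
have [b b0 bN] := posdef_coordinate z_pos.
exists (b * a); first exact: mulr_ge0.
move=> e i j; have lez := L2vecM e lz.
have := bN j (row i e)^T; rewrite !mxE => /le_trans; apply.
rewrite -mulrA ler_wpM2l//.
have -> : mxbil N0 (row i e)^T (row i e)^T =
  cov P (fun w => e *m z w) (fun w => e *m z w) i i.
  rewrite covMl// covMr// -/N0 /mxbil trmxK tr_row.
  by rewrite -row_mul mulmxA -[LHS]/(_ 0 0) colE mulmxA -row_mul -colE !mxE.
rewrite mxE trform_cov// -meanZ; last exact: L1_mxbil.
apply: le_mean; [exact: L2M|by apply: L1Z; exact: L1_mxbil|].
by move=> w; rewrite -expr2; exact: aR.
Qed.

Lemma linear_gain_op t : linear (gain_op t).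
Proof.
have lin (A : 'M[K]_n) (B : 'M[K]_m) a u v :
    A *m (a *: u + v) *m B = a *: (A *m u *m B) + A *m v *m B.
  by rewrite mulmxDr mulmxDl -scalemxAr -scalemxAl.
by move=> a u v; rewrite /gain_op !lin scalerBr opprD addrACA.
Qed.

Let gain_opE t e : gain_op t e = R *m e *m (G + N0) - 2 *: (D *m e *m G) -
  (2 * t) *: (D *m e *m N0) + t *: (Q *m e *m G) + (t * t) *: (Q *m e *m N0).
Proof.
rewrite /gain_op; move: (R *m e *m _) => Z.
rewrite !mulmxBl !mulmxDr -!scalemxAl -!scalemxAr.
move: (D *m e *m G) (D *m e *m N0) (Q *m e *m G) (Q *m e *m N0) => X1 X2 X3 X4.
by apply/matrixP => i j; rewrite !mxE; ring.
Qed.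

(** Coercivity makes gain_op t injective, hence onto. Applied to e = p t - p 0
    it also bounds e, since gain_op t e is O(t). *)
Lemma optimal_gain : exists p : K -> 'M[K]_(n, m),
  (forall t, 0 <= t <= 1 -> gain_op t (p t) = (D - t *: Q) *m C) /\
  exists L : K, forall t, 0 <= t <= 1 ->
    forall i j, `|p t i j - p 0 i j| <= L * t.
Proof.
have [c c0 cE] := gain_coordinate.
have inj t : 0 <= t <= 1 -> forall u, gain_op t u = 0 -> u = 0.
  move=> t01 u u0; apply/matrixP => i j; rewrite mxE; apply/eqP.
  rewrite -sqrf_eq0 eq_le sqr_ge0 andbT; apply: le_trans (cE u i j) _.
  have := gain_op_coercive u t01; rewrite u0 mulmx0 linear0 => H.
  by rewrite mulr_ge0_le0.
have sol t : exists u, 0 <= t <= 1 -> gain_op t u = (D - t *: Q) *m C.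
  have [t01|] := boolP (0 <= t <= 1); last by exists 0.
  have [u uE] := injective_linear_onto (linear_gain_op t) (inj t t01)
    ((D - t *: Q) *m C).
  by exists u.
have [p pE] := choice sol; exists p; split=> //.
have p0E : gain_op 0 (p 0) = D *m C.
  by rewrite pE ?lexx ?ler01// scale0r subr0.
pose A := (2 *: D) *m p 0 *m N0 - Q *m C - Q *m p 0 *m G.
pose B := - (Q *m p 0 *m N0).
pose M := \sum_i \sum_j (`|A i j| + `|B i j|).
have M0 : 0 <= M.
  by apply: sumr_ge0 => i _; apply: sumr_ge0 => j _; rewrite addr_ge0.
exists ((n%:R * m%:R) ^+ 2 * (c * M)) => t t01 i j.
have /andP[t0 t1] := t01.
pose e := p t - p 0.
have eE : gain_op t e = t *: (A + t *: B).
  have -> : gain_op t e = gain_op t (p t) - gain_op t (p 0).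
    by rewrite /e -scaleN1r addrC linear_gain_op scaleN1r addrC.
  rewrite pE// (gain_opE t (p 0)).
  move: p0E; rewrite gain_opE mulr0 mul0r !scale0r subr0 !addr0 => ->.
  rewrite mulmxBl -scalemxAl /A /B -scalemxAl -scalemxAl.
  move: (D *m C) (Q *m C) (D *m p 0 *m N0) (Q *m p 0 *m G) (Q *m p 0 *m N0).
  by move=> X1 X2 X3 X4 X5; apply/matrixP => k l; rewrite !mxE; ring.
have trE : \tr (e^T *m gain_op t e) <= t * (M * \sum_k \sum_l `|e k l|).
  rewrite eE -scalemxAr linearZ/= ler_wpM2l// /mxtrace.
  rewrite (eq_bigr (fun l => \sum_k e k l * (A + t *: B) k l)); last first.
    by move=> l _; rewrite mxE; apply: eq_bigr => k _; rewrite mxE.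
  rewrite exchange_big/= mulr_sumr; apply: ler_sum => k _.
  rewrite mulr_sumr; apply: ler_sum => l _.
  apply: le_trans (ler_norm _) _; rewrite normrM mulrC ler_wpM2r//.
  apply: (@le_trans _ _ (`|A k l| + `|B k l|)).
    rewrite !mxE; apply: le_trans (ler_normD _ _) _;
      rewrite lerD2l normrM ger0_norm//.
    by rewrite ler_piMl.
  rewrite /M (bigD1 k)//= (bigD1 l)//= -addrA lerDl addr_ge0//.
    by apply: sumr_ge0 => j' _; rewrite addr_ge0.
  by apply: sumr_ge0 => i' _; apply: sumr_ge0 => j' _; rewrite addr_ge0.
have key k l : e k l ^+ 2 <= (c * M * t) * \sum_k \sum_l `|e k l|.
  apply: le_trans (cE e k l) _; rewrite -!mulrA ler_wpM2l//.
  apply: le_trans (gain_op_coercive e t01) _; apply: le_trans trE _.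
  by rewrite mulrCA.
have := sqr_entries_bound key (mulr_ge0 (mulr_ge0 c0 M0) t0).
rewrite [X in _ <= X -> _]mulrA => H.
apply: le_trans H; rewrite (_ : _ - _ = e i j); last by rewrite !mxE.
rewrite (bigD1 i)//= (bigD1 j)//= -addrA lerDl addr_ge0 ?sumr_ge0// => k _.
by rewrite sumr_ge0.
Qed.

End Gain.

(** * Upper limits, entrywise bounds and infinite expectations *)

Lemma le_limn_esup (K : realType) (a b : nat -> \bar K) :
  (forall e : K, 0 < e -> \forall N \near \oo, (a N <= b N + e%:E)%E) ->
  (limn_esup a <= limn_esup b)%E.
Proof.
move=> ab; apply: le_ereal_inf_tmp => _ [A Aoo <-]; apply/lee_addgt0Pr => e e0.
apply: (@le_trans _ _
  (ereal_sup (a @` (A `&` [set N | (a N <= b N + e%:E)%E])))).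
  apply: ereal_inf_lbound; exists (A `&` [set N | (a N <= b N + e%:E)%E]) => //.
  by apply: filterI => //; exact: ab.
apply: ge_ereal_sup => _ [N [AN abN] <-]; apply: le_trans abN _.
by rewrite leeD2r//; apply: ereal_sup_ubound; exists N.
Qed.

Section EntryBounds.
Context (K : realType).

Lemma matrix_bounded m n (A : 'M[K]_(m, n)) :
  exists2 a, 0 <= a & forall i j, `|A i j| <= a.
Proof.
exists (\sum_i \sum_j `|A i j|).
  by apply: sumr_ge0 => i _; apply: sumr_ge0.
move=> i j; rewrite (bigD1 i)//= (bigD1 j)//=
  -addrA lerDl addr_ge0 ?sumr_ge0// => k _.
by rewrite sumr_ge0.
Qed.

Lemma mulmx_bounded m n p (A : 'M[K]_(m, n)) (B : 'M[K]_(n, p)) a b :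
  (forall i j, `|A i j| <= a) -> (forall i j, `|B i j| <= b) ->
  forall i j, `|(A *m B) i j| <= n%:R * (a * b).
Proof.
move=> Aa Bb i j; rewrite mxE; apply: le_trans (ler_norm_sum _ _ _) _.
rewrite -[n in n%:R]card_ord mulr_natl -sumr_const; apply: ler_sum => k _.
by rewrite normrM; apply: ler_pM.
Qed.

Lemma trform_small n m (M : 'M[K]_n) (W : 'M[K]_m) :
  exists2 c, 0 <= c & forall (e : 'M[K]_(n, m)) r,
    (forall i j, `|e i j| <= r) -> trform M e W <= c * r ^+ 2.
Proof.
have [a a0 Ma] := matrix_bounded M; have [b b0 Wb] := matrix_bounded W.
exists (m%:R * (m%:R * (n%:R * (n%:R * a) * b))).
  by rewrite !mulr_ge0.
move=> e r er; rewrite /trform /mxtrace.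
have eTr i j : `|e^T i j| <= r by rewrite mxE.
have H := mulmx_bounded (mulmx_bounded (mulmx_bounded eTr Ma) er) Wb.
apply: (@le_trans _ _
  (\sum_(i < m) (m%:R * (n%:R * (n%:R * (r * a) * r) * b)))).
  by apply: ler_sum => i _; apply: le_trans (ler_norm _) (H i i).
rewrite sumr_const card_ord -[leLHS]mulr_natl.
by rewrite le_eqVlt; apply/orP; left; apply/eqP; ring.
Qed.

Lemma cvg_mx_entries m n (f : nat -> 'M[K]_(m, n)) (l : 'M[K]_(m, n)) (c : K) :
  (forall N i j, `|f N i j - l i j| <= c / N%:R) ->
  f N @[N --> \oo] --> l.
Proof.
move=> fl; apply/cvgrPdist_le => e e0.
have c0 : 0 <= `|c| + 1 by rewrite addr_ge0.
exists (Num.truncn ((`|c| + 1) / e)).+1 => // N /= Ne.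
have N0 : 0 < N%:R :> K by rewrite ltr0n; apply: leq_trans Ne.
have cN : (`|c| + 1) / e <= N%:R.
  by apply/ltW/(lt_le_trans (truncnS_gt _)); rewrite ler_nat.
have cNe : (`|c| + 1) / N%:R <= e.
  by rewrite ler_pdivrMr// mulrC -ler_pdivrMr.
rewrite /Num.norm/= mx_normrE; apply/bigmax_leP; split; first exact: ltW.
move=> [i j] _; rewrite /= !mxE distrC; apply: le_trans (fl N i j) _.
apply: le_trans cNe; rewrite ler_pM2r ?invr_gt0//.
by apply: le_trans (ler_norm c) _; rewrite lerDl.
Qed.

End EntryBounds.

Section ExtendedMean.
Context (d : measure_display) (T : measurableType d) (K : realType)
  (P : probability T K).

Lemma expectation_L1 (f : T -> K) : L1 P f -> ('E_P[f] = (mean P f)%:E)%E.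
Proof.
move=> lf; rewrite unlock /mean /Rintegral fineK//.
exact: integrable_fin_num.
Qed.

(** The lower bound makes the negative part of f integrable. *)
Lemma expectation_L1_or_pinfty (f h : T -> K) : measurable_fun setT f ->
  L1 P h ->
  (forall w, - h w <= f w) -> L1 P f \/ ('E_P[f] = +oo)%E.
Proof.
move=> mf lh hf.
have [|foo] := ltP (\int[P]_w `|(f w)%:E|)%E +oo%E.
  by move=> H; left; apply/integrableP; split => //; exact/measurable_EFinP.
right; rewrite unlock integralE.
have mfE : measurable_fun setT (EFin \o f) by exact/measurable_EFinP.
have neg : (\int[P]_w (EFin \o f)^\- w < +oo)%E.
  have /integrableP[mh] := lh; apply: le_lt_trans; apply: ge0_le_integral => //.
  - exact: measurable_funeneg.
  - exact: measurableT_comp.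
  - move=> w _; rewrite funenegE /= -EFin_max lee_fin ge_max normr_ge0 andbT.
    by apply: le_trans (ler_norm _); rewrite lerNl.
have neg0 : (0 <= \int[P]_w (EFin \o f)^\- w)%E by apply: integral_ge0.
have : (\int[P]_w `|(EFin \o f) w| = +oo)%E by apply/eqP; rewrite -leye_eq.
rewrite -[X in (\int[P]_w X w)%E]/(abse \o (EFin \o f)) fune_abse.
rewrite ge0_integralD//; last 2 first.
- exact: measurable_funepos.
- exact: measurable_funeneg.
have pos0 : (0 <= \int[P]_w (EFin \o f)^\+ w)%E by apply: integral_ge0.
move: neg neg0 pos0; case: (\int[P]_w (EFin \o f)^\- w)%E => [r| |] // _ _.
by case: (\int[P]_w (EFin \o f)^\+ w)%E => [s| |].
Qed.

End ExtendedMean.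

(** * Optimality of linear policies *)

Section Team.
Context (d : measure_display) (T : measurableType d) (K : realType)
  (P : probability T K) (n m : nat).
Variables (x : T -> 'cV[K]_n) (z : nat -> T -> 'cV[K]_m).
Variables (H : 'M[K]_(m, n)) (R D Q : 'M[K]_n).
Hypothesis mx : measurable_fun setT x.
Hypothesis mz : forall k, measurable_fun setT (z k).
Hypothesis lx : L2vec P x.
Hypothesis lz : forall k, L2vec P (z k).
Hypothesis x0 : zero_mean P x.
Hypothesis z0 : forall k, zero_mean P (z k).
Hypothesis gx : gaussian_vector P x.
Hypothesis gz : forall k, gaussian_vector P (z k).
Hypothesis xz_indep : independent_noise P x z.
Hypothesis R_pos : posdefmx R.
Hypothesis D_ge0 : possemidefmx D.
Hypothesis Q_ge0 : possemidefmx Q.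
Hypothesis R_gt2D : posdefmx (R - 2 *: D).
Hypothesis z_pos : posdefmx (cov P (z 0%N) (z 0%N)).
Hypothesis z_cov : forall k, cov P (z k) (z k) = cov P (z 0%N) (z 0%N).

Local Notation v := (observation H x z).
Local Notation g := (fun w => H *m x w).
Local Notation C := (cov P x x *m H^T).
Let G := cov P g g.
Let N0 := cov P (z 0%N) (z 0%N).

Let lg : L2vec P g. Proof. exact: L2vecM. Qed.

Let lv k : L2vec P (v k). Proof. exact: L2vecD. Qed.

Let mv k : measurable_fun setT (v k).
Proof.
apply: measurable_mx => i j; rewrite (ord1 j).
exact: L2_measurable (lv k i).
Qed.

Let linear_v N k : (k < N)%N -> linear_vector x z N (v k).
Proof.
move=> kN; apply: linear_vectorD; last exact: linear_vector_noise.
by apply: linear_vectorM; exact: linear_vector_state.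
Qed.

Let cov_xz k : cov P x (z k) = 0.
Proof. exact: cov_state_noise. Qed.

Lemma cov_state_observation i : cov P x (v i) = C.
Proof. by rewrite covDr// cov_xz addr0 covMr. Qed.

Lemma cov_observations k i : cov P (v k) (v i) = G + (k == i)%:R *: N0.
Proof.
rewrite covDl// !covDr// -/G.
have -> : cov P g (z i) = 0 by rewrite covMl// cov_xz mulmx0.
have -> : cov P (z k) g = 0 by rewrite covMr// -cov_tr cov_xz trmx0 mul0mx.
rewrite addr0 add0r; have [->|ki] := eqVneq k i; first by rewrite z_cov scale1r.
by rewrite scale0r (cov_noise_noise mx mz lx lz x0 z0 xz_indep ki).
Qed.

Section FixedSize.
Variable N : nat.
Hypothesis N_gt0 : (0 < N)%N.
Let t : K := N%:R^-1.

Let tN : t * N%:R = 1.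
Proof. by rewrite mulVf// pnatr_eq0 -lt0n. Qed.

Let total (p : 'M[K]_(n, m)) (w : T) := \sum_(k < N) p *m v k w.

Let linear_total p : linear_vector x z N (total p).
Proof.
by apply: (linear_vector_sum (X := fun k w => p *m v k w)) => k kN;
  apply: linear_vectorM; exact: linear_v.
Qed.

Let ltotal p : L2vec P (total p).
Proof. by apply: L2vec_sum => k; exact: L2vecM. Qed.

Let cov_total p i : (i < N)%N ->
  t *: cov P (total p) (v i) = p *m (G + t *: N0).
Proof.
move=> iN; rewrite cov_suml => [|k|//]; last exact: L2vecM.
rewrite (eq_bigr (fun k : 'I_N => p *m G + (val k == i)%:R *: (p *m N0)));
  last first.
  by move=> k _; rewrite covMl// cov_observations mulmxDr -scalemxAr.
rewrite big_split/= sumr_const card_ord -scaler_suml.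
rewrite (bigD1 (Ordinal iN))//= eqxx big1 ?addr0 => [|k ki]; last first.
  by rewrite (negbTE (_ : val k != i))//; apply: contra ki => /eqP ki;
    apply/eqP/val_inj.
by rewrite -scaler_nat scalerDr scalerA tN !scale1r mulmxDr -scalemxAr.
Qed.

(** Half the partial gradient of the loss, at the linear policy with gain p. *)
Definition residual (p : 'M[K]_(n, m)) (i : 'I_N) (w : T) : 'cV[K]_n :=
  marginal R D Q (x w) (fun k : 'I_N => p *m v k w) i.

Let residualE p i : residual p i = fun w => R *m (p *m v i w) +
  ((- D) *m (x w + (2 * t) *: total p w) + t *: (Q *m (x w + t *: total p w))).
Proof. by apply/funext => w; rewrite /residual /marginal mulNmx addrA. Qed.

Lemma linear_residual p i : linear_vector x z N (residual p i).
Proof.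
rewrite residualE; apply: linear_vectorD.
  by do 2 apply: linear_vectorM; exact: linear_v.
apply: linear_vectorD.
  apply: linear_vectorM; apply: linear_vectorD;
    first exact: linear_vector_state.
  exact/linear_vectorZ/linear_total.
apply: linear_vectorZ; apply: linear_vectorM; apply: linear_vectorD.
  exact: linear_vector_state.
exact/linear_vectorZ/linear_total.
Qed.

Let lresidual p i : L2vec P (residual p i).
Proof.
exact: (L2vec_linear lx lz (linear_residual p i)).
Qed.

(** The covariance of residual p i and v i is
    gain_op (1/N) p - (D - Q / N) C. *)
Lemma residual_uncorrelated p i :
  gain_op P R D Q g (z 0%N) t p = (D - t *: Q) *m C ->
  cov P (residual p i) (v i) = 0.
Proof.
move=> pE; have lpv := L2vecM p (lv i).
have lA := L2vecD lx (L2vecZ (2 * t) (ltotal p)).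
have lB := L2vecD lx (L2vecZ t (ltotal p)).
have lQB := L2vecM Q lB.
rewrite residualE covDl//; last 2 first.
- exact: L2vecM.
- by apply: L2vecD; [exact: L2vecM|exact: L2vecZ].
rewrite covDl//; [|exact: L2vecM|exact: L2vecZ].
rewrite covMl// covMl// covMl// covZl// covMl//.
rewrite cov_observations eqxx scale1r !covDl//; [|exact: L2vecZ..].
rewrite !covZl// -scalerA cov_total// cov_state_observation.
move: pE; rewrite /gain_op -/G -/N0 !mulmxA.
rewrite !mulmxDr !scalerDr !mulmxBl -!scalemxAl -!scalemxAr !mulmxA.
rewrite !mulmxDr -!scalemxAr !mulmxA !mulNmx.
move: (R *m p *m G) (R *m p *m N0) (D *m p *m G) (Q *m p *m G) (D *m p *m N0)
  (Q *m p *m N0) (D *m cov P x x *m H^T) (Q *m cov P x x *m H^T).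
move=> X1 X2 X3 X4 X5 X6 X7 X8 /eqP; rewrite -subr_eq0 => /eqP <-.
by apply/matrixP => a b; rewrite !mxE; ring.
Qed.

Definition policy_loss (gam : 'I_N -> 'cV[K]_m -> 'cV[K]_n) (w : T) : K :=
  team_loss R D Q (x w) (fun i : 'I_N => gam i (v i w)).

Definition linear_policy (p : 'M[K]_(n, m)) (i : 'I_N) (y : 'cV[K]_m) :
  'cV[K]_n :=
  p *m y.

Let deviation p (gam : 'I_N -> 'cV[K]_m -> 'cV[K]_n) (i : 'I_N) (w : T) :=
  gam i (v i w) - p *m v i w.

Lemma measurable_mxbil (M : 'M[K]_n) (X Y : T -> 'cV[K]_n) :
  (forall i, measurable_fun setT (fun w => X w i 0)) ->
  (forall i, measurable_fun setT (fun w => Y w i 0)) ->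
  measurable_fun setT (fun w => mxbil M (X w) (Y w)).
Proof.
move=> mX mY; under eq_fun do rewrite mxbilE.
apply: measurable_sum => i; apply: measurable_sum => j.
by apply: measurable_funM; [exact: measurable_cst|exact: measurable_funM].
Qed.

Let u_entry (gam : 'I_N -> 'cV[K]_m -> 'cV[K]_n) i j :
  measurable_fun setT (gam i) ->
    measurable_fun setT (fun w => gam i (v i w) j 0).
Proof.
by move=> mg; apply: measurable_fun_entry; exact: (measurableT_comp mg (mv i)).
Qed.

Lemma measurable_policy_loss gam : policies gam ->
  measurable_fun setT (policy_loss gam).
Proof.
move=> mgam.
have mu i j := @u_entry gam i j (mgam i).
have my j : measurable_fun setT (fun w =>
    (x w + t *: \sum_(k < N) gam k (v k w)) j 0).
  under eq_fun do rewrite !mxE summxE.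
  apply: measurable_funD; first exact: measurable_fun_entry.
  apply: measurable_funM; first exact: measurable_cst.
  exact: measurable_sum.
apply: measurable_funD; last exact: measurable_mxbil.
apply: measurable_funB; first by apply: measurable_sum => i;
  exact: measurable_mxbil.
apply: measurable_funM; first exact: measurable_cst.
by apply: measurable_sum => i; exact: measurable_mxbil.
Qed.

Lemma L1_policy_loss gam :
  (forall i : 'I_N, L2vec P (fun w => gam i (v i w))) ->
  L1 P (policy_loss gam).
Proof.
move=> lu.
have ly : L2vec P (fun w => x w + t *: \sum_(k < N) gam k (v k w)).
  by apply: L2vecD => //; apply: L2vecZ; exact: L2vec_sum.
apply: L1D; last exact: L1_mxbil.
apply: L1B; first by apply: L1_sum => i; exact: L1_mxbil.
by apply: L1Z; apply: L1_sum => i; exact: L1_mxbil.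
Qed.

Lemma L1_linear_loss p : L1 P (policy_loss (linear_policy p)).
Proof. by apply: L1_policy_loss => i; exact: L2vecM. Qed.

Let lossE p gam w : policy_loss gam w = policy_loss (linear_policy p) w +
  2 * \sum_i dot (deviation p gam i w) (residual p i w) +
  team_curvature R D Q (fun i => deviation p gam i w).
Proof.
have [RT _] := R_pos.
rewrite /policy_loss -(team_loss_expansion RT D_ge0 Q_ge0).
by congr team_loss; apply/funext => i;
  rewrite /linear_policy /deviation addrC subrK.
Qed.

Let L1_curvature (e : 'I_N -> T -> 'cV[K]_n) : (forall i, L2vec P (e i)) ->
  L1 P (fun w => team_curvature R D Q (fun i => e i w)).
Proof.
move=> le; have lS : L2vec P (fun w => \sum_(i < N) e i w) by exact: L2vec_sum.
apply: L1D; last by apply: L1Z; exact: L1_mxbil.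
apply: L1B; last by apply: L1Z; exact: L1_mxbil.
by apply: L1_sum => i; exact: L1_mxbil.
Qed.

Section OptimalGain.
Variable p : 'M[K]_(n, m).
Hypothesis pE : gain_op P R D Q g (z 0%N) t p = (D - t *: Q) *m C.

(** Stationarity: a deviation at i is a function of v i. *)
Lemma first_order gam i : measurable_fun setT (gam i) ->
  L2vec P (deviation p gam i) ->
  L1 P (fun w => dot (deviation p gam i w) (residual p i w)) /\
  mean P (fun w => dot (deviation p gam i w) (residual p i w)) = 0.
Proof.
move=> mgam ld.
have dE : (fun w => dot (deviation p gam i w) (residual p i w)) =
    (fun w => \sum_j residual p i w j 0 * (gam i (v i w) - p *m v i w) j 0).
  by apply/funext => w; rewrite dotE; apply: eq_bigr => j _; rewrite mulrC.
have l1 j : L1 P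
  (fun w => residual p i w j 0 * (gam i (v i w) - p *m v i w) j 0).
  by apply: L2M; [exact: lresidual|exact: ld].
rewrite dE; split; first exact: L1_sum.
rewrite mean_sum// big1// => j _.
have mdev : measurable_fun setT (fun y : 'cV[K]_m => (gam i y - p *m y) j 0).
  under eq_fun do rewrite !mxE; apply: measurable_funB.
    exact: (measurableT_comp (measurable_entry j 0) mgam).
  by apply: measurable_sum => k; apply: measurable_funM;
    [exact: measurable_cst|exact: measurable_entry].
have := uncorrelated_orthogonal mx mz lx lz x0 z0 gx gz xz_indep
  (linear_v (ltn_ord i)) (linear_residual p i)
    (residual_uncorrelated i pE) j mdev.
by apply; exact: ld.
Qed.

Lemma mean_policy_loss gam : policies gam ->
  (forall i, L2vec P (deviation p gam i)) ->
  L1 P (policy_loss gam) /\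
  mean P (policy_loss gam) = mean P (policy_loss (linear_policy p)) +
    mean P (fun w => team_curvature R D Q (fun i => deviation p gam i w)).
Proof.
move=> mgam ld.
have l1 := L1_linear_loss p; have l3 := L1_curvature ld.
have l2 : L1 P (fun w => \sum_i dot (deviation p gam i w) (residual p i w)).
  by apply: L1_sum => i; case: (first_order (mgam i) (ld i)).
have -> : policy_loss gam = fun w => policy_loss (linear_policy p) w +
    2 * \sum_i dot (deviation p gam i w) (residual p i w) +
    team_curvature R D Q (fun i => deviation p gam i w).
  by apply/funext => w; exact: lossE.
have l12 : L1 P (fun w => policy_loss (linear_policy p) w +
    2 * \sum_i dot (deviation p gam i w) (residual p i w)).
  by apply: L1D => //; exact: L1Z.
split; first exact: L1D.
rewrite meanD// meanD//; last exact: L1Z.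
rewrite meanZ// mean_sum => [|i]; last by case: (first_order (mgam i) (ld i)).
by rewrite big1 ?mulr0 ?addr0// => i _; case: (first_order (mgam i) (ld i)).
Qed.

Let S := R - 2 *: D.

(** An integrable variable such that loss + slack dominates the squared
    deviations from the linear policy. *)
Let slack (w : T) : K :=
  2 * \sum_(i < N) mxbil (invmx S) (residual p i w) (residual p i w)
  - policy_loss (linear_policy p) w.

Let L1_slack : L1 P slack.
Proof.
apply: L1B; last exact: L1_linear_loss.
by apply: L1Z; apply: L1_sum => i; apply: L1_mxbil; exact: lresidual.
Qed.

Let slackP gam w :
  2^-1 * \sum_i mxbil S (deviation p gam i w) (deviation p gam i w) <=
  policy_loss gam w + slack w.
Proof.
rewrite (lossE p) /slack.
have := team_curvature_ge R D_ge0 Q_ge0 N_gt0 (fun i => deviation p gam i w).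
have : 0 <= \sum_i (2^-1 * mxbil S (deviation p gam i w) (deviation p gam i w) +
    2 * dot (deviation p gam i w) (residual p i w) +
    2 * mxbil (invmx S) (residual p i w) (residual p i w)).
  by apply: sumr_ge0 => i _; exact: posdef_young.
rewrite !big_split/= -!mulr_sumr -/S; lra.
Qed.

(** A policy of finite cost differs from the linear one by square-integrable
    deviations. *)
Lemma policy_loss_dichotomy gam : policies gam ->
  (L1 P (policy_loss gam) /\ forall i, L2vec P (deviation p gam i)) \/
  ('E_P[policy_loss gam] = +oo)%E.
Proof.
move=> mgam; have [_ S0] := posdef_possemidef R_gt2D.
have dev0 w i : 0 <= mxbil S (deviation p gam i w) (deviation p gam i w).
  exact: S0.
have [|||lgam|goo] := @expectation_L1_or_pinfty _ _ _ P (policy_loss gam) slack.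
- exact: measurable_policy_loss.
- exact: L1_slack.
- move=> w; have := slackP gam w.
  have : 0 <= \sum_i mxbil S (deviation p gam i w) (deviation p gam i w).
    exact: sumr_ge0.
  lra.
- left; split=> // i j.
  have [c c0 cS] := posdef_coordinate R_gt2D.
  apply: (@le_L2 _ _ _ _ _ (fun w => c * (2 * (policy_loss gam w + slack w)))).
  + under eq_fun do rewrite !mxE; apply: measurable_funB; first exact: u_entry.
    by apply: measurable_sum => k; apply: measurable_funM;
      [exact: measurable_cst|exact: measurable_fun_entry].
  + move=> w; apply: le_trans (cS j _) _; rewrite ler_wpM2l//.
    have := slackP gam w; rewrite (bigD1 i)//= -/S.
    have : 0 <= \sum_(k | k != i) mxbil S (deviation p gam k w)
      (deviation p gam k w).
      by apply: sumr_ge0.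
    lra.
  + by do 2 apply: L1Z; apply: L1D.
- by right.
Qed.

Local Notation cost := (team_cost P R D Q x v (N := N)).

Let costE gam : L1 P (policy_loss gam) ->
  cost gam = (t * mean P (policy_loss gam))%:E.
Proof. by move=> lgam; rewrite /team_cost expectation_L1// -EFinM. Qed.

Let t_gt0 : 0 < t. Proof. by rewrite invr_gt0 ltr0n. Qed.

Lemma linear_policy_le gam : policies gam ->
  (cost (linear_policy p) <= cost gam)%E.
Proof.
move=> mgam; rewrite (costE (L1_linear_loss p)).
have [[lgam ld]|goo] := policy_loss_dichotomy mgam; last first.
  by rewrite /team_cost -/(policy_loss gam) goo gt0_muley ?leey// lte_fin.
rewrite costE// lee_fin ler_pM2l//.
have [_ ->] := mean_policy_loss mgam ld; rewrite lerDl; apply: mean_ge0 => w.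
apply: le_trans (team_curvature_ge R D_ge0 Q_ge0 N_gt0 _).
by apply: sumr_ge0 => i _; have [_] := posdef_possemidef R_gt2D; apply.
Qed.

Lemma linear_policies q : policies (linear_policy q).
Proof.
move=> i; apply: measurable_mx => k l; apply: measurable_mulmx_entry => a b.
exact: measurable_entry.
Qed.

(** By stationarity the excess cost is the mean of the quadratic part of the
    loss at the deviations (q - p) v i, which share the covariance
    (q - p) (G + N0) (q - p)^T. *)
Lemma linear_policy_gap q : (cost (linear_policy q) <=
  cost (linear_policy p) + (trform (R + Q) (q - p) (G + N0))%:E)%E.
Proof.
rewrite !costE; try exact: L1_linear_loss.
rewrite -EFinD lee_fin.
have devE i : deviation p (linear_policy q) i = fun w => (q - p) *m v i w.
  by apply/funext => w; rewrite /deviation mulmxBl.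
have ld i : L2vec P (deviation p (linear_policy q) i).
  by rewrite devE; exact: L2vecM.
have [_ ->] := mean_policy_loss (linear_policies q) ld.
rewrite mulrDr lerD2l.
have le1 i : L1 P (fun w => mxbil (R + Q) (deviation p (linear_policy q) i w)
    (deviation p (linear_policy q) i w)) by exact: L1_mxbil.
apply: (@le_trans _ _ (t * mean P (fun w => \sum_i mxbil (R + Q)
    (deviation p (linear_policy q) i w) (deviation p (linear_policy q) i w)))).
  rewrite ler_pM2l//; apply: le_mean; [exact: L1_curvature|exact: L1_sum|].
  by move=> w; exact: team_curvature_le.
rewrite mean_sum// (eq_bigr (fun=> trform (R + Q) (q - p) (G + N0))).
  by rewrite sumr_const card_ord -[X in t * X]mulr_natl mulrA tN mul1r.
move=> i _; have <- : cov P (v i) (v i) = G + N0.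
  by rewrite cov_observations eqxx scale1r.
by rewrite trform_cov// devE.
Qed.

End OptimalGain.
End FixedSize.
End Team.

Theorem theorem15 (K : realType) (m n : nat)
    (d : measure_display) (T : measurableType d) (P : probability T K)
    (x : {RV P >-> 'cV[K]_n}) (z : nat -> {RV P >-> 'cV[K]_m})
    (Sigma00 : 'M[K]_n) (N0 : 'M[K]_m) (H : 'M[K]_(m, n)) (R D Q : 'M[K]_n)
    (R_pos : posdefmx R) (D_ge0 : possemidefmx D) (Q_ge0 : possemidefmx Q)
    (R_gt2D : posdefmx (R - 2 *: D))
    (x_gauss : gaussian_vector P x) (x_mean : zero_mean P x)
    (x_cov : has_covariance P x Sigma00)
    (N0_pos : posdefmx N0)
    (z_gauss : forall i, gaussian_vector P (z i))
    (z_mean : forall i, zero_mean P (z i))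
    (z_cov : forall i, has_covariance P (z i) N0)
    (z_id : identically_distributed P (fun i => z i : T -> 'cV[K]_m))
    (xz_indep : independent_noise P x (fun i => z i : T -> 'cV[K]_m)) :
  let v := observation H x (fun i => z i : T -> 'cV[K]_m) in
  exists (pi_ : nat -> 'M[K]_(n, m)) (pi_oo : 'M[K]_(n, m)),
    let gamma_ N := fun (i : nat) (y : 'cV[K]_m) => pi_ N *m y in
    let gamma_oo := fun (i : nat) (y : 'cV[K]_m) => pi_oo *m y in
    [/\ forall N : nat, (0 < N)%N ->
          optimal (@policies K m n 'I_N) (@team_cost _ T K P m n R D Q x v N)
            (fun i : 'I_N => gamma_ N i),
        optimal (@policies K m n nat) (limit_cost P R D Q x v) gamma_oo
      & forall (i : nat) (y : 'cV[K]_m),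
          gamma_ N i y @[N --> \oo] --> gamma_oo i y].
Proof.
move=> v.
have mx : measurable_fun setT x by exact: measurable_funPT.
have mz k : measurable_fun setT (z k) by exact: measurable_funPT.
have lx := has_covariance_L2vec mx x_cov.
have lz k := has_covariance_L2vec (mz k) (z_cov k).
have covz k : cov P (z k) (z k) = N0 by exact/has_covarianceE/z_cov.
have z_pos : posdefmx (cov P (z 0%N) (z 0%N)) by rewrite covz.
have covz0 k : cov P (z k) (z k) = cov P (z 0%N) (z 0%N) by rewrite !covz.
pose g := fun w => H *m x w.
have lg : L2vec P g by exact: L2vecM.
pose C := cov P x x *m H^T.
have [p [pE [L pL]]] := optimal_gain C D_ge0 Q_ge0 R_gt2D lg (lz 0%N) z_pos.
have inv01 (N : nat) : 0 <= (N%:R^-1 : K) <= 1.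
  case: N => [|N]; first by rewrite invr0 lexx ler01.
  by rewrite invr_ge0 ler0n invf_le1 ?ltr0n// ler1n.
have gainE N :
  gain_op P R D Q g (z 0%N) N%:R^-1 (p N%:R^-1) = (D - N%:R^-1 *: Q) *m C.
  exact: pE.
have pN N i j : `|p N%:R^-1 i j - p 0 i j| <= L / N%:R by exact: pL.
exists (fun N => p N%:R^-1), (p 0); split.
- move=> N N_gt0; split; first exact: linear_policies.
  apply/eqP; rewrite eq_le; apply/andP; split.
    apply: le_ereal_inf_tmp => _ [gam mgam <-].
    exact: (linear_policy_le mx mz lx lz x_mean z_mean x_gauss z_gauss xz_indep
      R_pos D_ge0 Q_ge0 R_gt2D covz0 N_gt0 (gainE N) mgam).
  apply: ereal_inf_lbound; exists (linear_policy (p N%:R^-1)) => //.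
  exact: linear_policies.
- have mlin : policies (fun (i : nat) (y : 'cV[K]_m) => p 0 *m y).
    move=> i; exact: (@linear_policies K n m 1 (p 0) ord0).
  split=> //; apply/eqP; rewrite eq_le; apply/andP; split; last first.
    by apply: ereal_inf_lbound;
      exists (fun (i : nat) (y : 'cV[K]_m) => p 0 *m y).
  apply: le_ereal_inf_tmp => _ [gam mgam <-]; apply: le_limn_esup => e e0.
  have [c c0 cE] := trform_small (R + Q) (cov P g g + N0).
  have cL0 : 0 <= c * L ^+ 2 + 1 by rewrite addr_ge0// mulr_ge0// sqr_ge0.
  exists (Num.truncn ((c * L ^+ 2 + 1) / e)).+1 => // N /= Ne.
  have N_gt0 : (0 < N)%N by apply: leq_trans Ne.
  have Nr : 0 < N%:R :> K by rewrite ltr0n.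
  have gap := linear_policy_gap mx mz lx lz x_mean z_mean x_gauss z_gauss
    xz_indep
      R_pos D_ge0 Q_ge0 covz0 N_gt0 (gainE N) (p 0).
  apply: (le_trans gap).
  apply: leeD.
    exact: (linear_policy_le mx mz lx lz x_mean z_mean x_gauss z_gauss xz_indep
      R_pos D_ge0 Q_ge0 R_gt2D covz0 N_gt0 (gainE N) (gam := fun i :
        'I_N => gam i)).
  rewrite lee_fin covz; apply: le_trans (cE _ (L / N%:R) _) _.
    by move=> i j; rewrite !mxE distrC.
  have N1 : 1 <= N%:R :> K by rewrite ler1n.
  have eN : (c * L ^+ 2 + 1) / e <= N%:R.
    by apply/ltW/(lt_le_trans (truncnS_gt _)); rewrite ler_nat.
  apply: (@le_trans _ _ ((c * L ^+ 2 + 1) / N%:R)); last first.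
    by rewrite ler_pdivrMr// [e * _]mulrC -ler_pdivrMr.
  have -> : c * (L / N%:R) ^+ 2 = c * L ^+ 2 * N%:R^-1 / N%:R.
    by field; rewrite gt_eqF.
  rewrite ler_pM2r ?invr_gt0//.
  have cL : 0 <= c * L ^+ 2 by rewrite mulr_ge0// sqr_ge0.
  apply: (@le_trans _ _ (c * L ^+ 2)); last by rewrite lerDl.
  by rewrite ler_piMr// invf_le1.
move=> i y; have [b b0 yb] := matrix_bounded y.
apply: (@cvg_mx_entries _ _ _ _ _ (m%:R * (L * b))) => N k l.
have -> : (p N%:R^-1 *m y) k l - (p 0 *m y) k l = ((p N%:R^-1 - p 0) *m y) k l.
  by rewrite mulmxBl !mxE.
have H1 := mulmx_bounded (a := L / N%:R) _ yb.
apply: le_trans (H1 _ (p N%:R^-1 - p 0) _ k l) _.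
  by move=> a a'; rewrite !mxE.
by rewrite mulrAC -!mulrA.
Qed.
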